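(* For every real number $k>1$ there exists $\varepsilon\in(0,\tfrac12)$ with $k(1-2\varepsilon)^2>1$ (so that partial recovery in the broadcast tree model with these parameters is possible), and yet there is a monotone cutting adversary for which partial recovery in the cutting semirandom broadcast tree model is information-theoretically impossible: no estimator of the root spin, as a function of the observed tree and the spins of its leaves, achieves partial recovery.
   Context: Broadcast tree model with parameters $k>0$, $\varepsilon\in[0,\frac12)$ and depth $R$ (equivalently $a=2k(1-\varepsilon)$, $b=2k\varepsilon$): the root $\rho$ (level 0) gets a uniformly random spin $\sigma_\rho\in\{\pm1\}$; each node gives birth independently to $\mathrm{Pois}(a/2)$ children of its own spin and $\mathrm{Pois}(b/2)$ children of the opposite spin, until level $R$; nodes at level $R$ are the leaves. Cutting semirandom model: sample such a precursor tree; an adversary (seeing the whole labeled tree) may delete any edges joining a node to a child of opposite spin, thereby removing the corresponding subtrees; the resulting tree (topology) together with the spins of its remaining leaves is observed, the removed subtrees are not revealed. An estimator $\hat\sigma_\rho$ achieves partial recovery if there exists $\eta>\frac12$ such that $\Pr[\hat\sigma_\rho=\sigma_\rho]\ge\eta$ as $R\to\infty$. (It is known that partial recovery in the random broadcast tree model is possible when $k(1-2\varepsilon)^2>1$.) *)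

(* Defs.v *)
From HB Require Import structures.
From mathcomp Require Import all_boot all_order all_algebra.
From mathcomp Require Import all_classical all_reals all_analysis.

Set Implicit Arguments.
Unset Strict Implicit.
Unset Printing Implicit Defensive.
Import Order.TTheory GRing.Theory Num.Theory.
Local Open Scope classical_set_scope.
Local Open Scope ring_scope.

Inductive tree (L : Type) : Type := Node of L & seq (tree L).

Section TreeChoice.
Variable L : Type.

Fixpoint tree_encode (t : tree L) : GenTree.tree L :=
  let: Node x cs := t in
  GenTree.Node 0 (GenTree.Leaf x :: map tree_encode cs).

Fixpoint tree_decode (g : GenTree.tree L) : option (tree L) :=
  if g is GenTree.Node _ (GenTree.Leaf x :: gs)
  then Some (Node x (pmap tree_decode gs)) else None.

Fixpoint tree_encodeK (t : tree L) : tree_decode (tree_encode t) = Some t.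
Proof.
case: t => x cs /=; congr (Some (Node x _)).
by elim: cs => //= c cs IHcs; rewrite tree_encodeK /= IHcs.
Qed.

End TreeChoice.

HB.instance Definition _ (L : eqType) :=
  Equality.copy (tree L) (pcan_type (@tree_encodeK L)).
HB.instance Definition _ (L : choiceType) :=
  Choice.copy (tree L) (pcan_type (@tree_encodeK L)).

Definition root_label (L : Type) (t : tree L) : L := let: Node x _ := t in x.

(* Isomorphism of rooted labelled trees, children being unordered. *)
Inductive tree_iso (L : Type) : tree L -> tree L -> Prop :=
| TreeIso x cs cs' : forest_iso cs cs' -> tree_iso (Node x cs) (Node x cs')
with forest_iso (L : Type) : seq (tree L) -> seq (tree L) -> Prop :=
| ForestIsoNil : forest_iso [::] [::]
| ForestIsoCons c c' cs cs1 cs2 :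
    tree_iso c c' -> forest_iso cs (cs1 ++ cs2) ->
    forest_iso (c :: cs) (cs1 ++ c' :: cs2).

(* Spins are booleans: true is +1, false is -1. *)

Section BroadcastTree.
Variable R : realType.

(* Probability mass function of the depth-d broadcast tree given the root spin
   s.  A node's own-spin children are listed before its opposite-spin ones;
   estimators, being invariant under tree_iso, cannot exploit this order. *)
Fixpoint broadcast_pmf (a b : R) (d : nat) (s : bool) (t : tree bool) : R :=
  if d is d'.+1 then
    let: Node x cs := t in
    let own := [seq c <- cs | root_label c == s] in
    let opp := [seq c <- cs | root_label c == ~~ s] in
    if (x == s) && (cs == own ++ opp) then
      (poisson_pmf (a / 2) (size own) *
         \prod_(c <- own) broadcast_pmf a b d' s c) *
      (poisson_pmf (b / 2) (size opp) *
         \prod_(c <- opp) broadcast_pmf a b d' (~~ s) c)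
    else 0
  else (t == Node s [::])%:R.

Definition broadcast_prob (a b : R) (d : nat) (A : set (tree bool)) : \bar R :=
  \esum_(t in A) (2^-1 * broadcast_pmf a b d (root_label t) t)%:E.

End BroadcastTree.

(* cut_tree t t': t' is obtained from t by deleting some edges between a node
   and a child of opposite spin, with the subtrees hanging from them. *)
Inductive cut_tree : tree bool -> tree bool -> Prop :=
| CutTree s cs cs' : cut_children s cs cs' -> cut_tree (Node s cs) (Node s cs')
with cut_children : bool -> seq (tree bool) -> seq (tree bool) -> Prop :=
| CutNil s : cut_children s [::] [::]
| CutDelete s c cs cs' :
    root_label c = ~~ s -> cut_children s cs cs' ->
    cut_children s (c :: cs) cs'
| CutKeep s c c' cs cs' :
    cut_tree c c' -> cut_children s cs cs' ->
    cut_children s (c :: cs) (c' :: cs').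

(* The first argument of adversaries and estimators is the depth. *)
Definition cutting_adversary (adv : nat -> tree bool -> tree bool) : Prop :=
  forall d t, cut_tree t (adv d t).

(* Only the nodes at level d, the leaves, keep their spin. *)
Fixpoint observe (d : nat) (t : tree bool) : tree (option bool) :=
  let: Node s cs := t in
  if d is d'.+1 then Node None [seq observe d' c | c <- cs]
  else Node (Some s) [::].

Definition root_estimator (est : nat -> tree (option bool) -> bool) : Prop :=
  forall d o o', tree_iso o o' -> est d o = est d o'.

Definition partial_recovery (R : realType) (a b : R)
    (adv : nat -> tree bool -> tree bool)
    (est : nat -> tree (option bool) -> bool) : Prop :=
  exists2 eta : R, 2^-1 < eta &
    \forall d \near \oo,
      (eta%:E <= broadcast_prob a b d
        [set t | est d (observe d (adv d t)) = root_label t])%E.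

(* Main.v *)
Require Import Defs.
From mathcomp Require Import all_boot all_order all_algebra.
From mathcomp Require Import all_classical all_reals all_analysis.
From mathcomp Require Import ring lra.
Import Order.TTheory GRing.Theory Num.Theory.
Import numFieldNormedType.Exports.
Set Implicit Arguments.
Unset Strict Implicit.
Unset Printing Implicit Defensive.
Local Open Scope classical_set_scope.
Local Open Scope ring_scope.

(** On a path u - v - w whose middle vertex has no other child, deleting the
    configurations where v differs from both u and w weakens the correlation
    between u and w, since these are configurations with w = u.  Deleting all of
    them would overshoot and make the correlation negative for small
    1 - 2 eps, so the deletion is made conditional on an event independent of
    everything observed: the adversary erases every childless child of v of spin
    opposite to v, and cuts v off only if it erased at least one.

    The adversary works on blocks of two levels.  The observed children of a
    vertex form a Poisson process whose intensity depends on its spin, and the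
    squared Hellinger distance of two Poisson processes is at most that of
    their intensities.  An edge contracts the squared Hellinger distance of the
    laws below the two spins by (1 - 2 eps)^2, a thinned path by strictly
    more than (1 - 2 eps)^4.  Hence one block multiplies it by a factor that is
    below 1 at k (1 - 2 eps)^2 = 1 and, by continuity, for slightly smaller
    eps.  The laws of the observation under the two root spins thus merge as
    the depth grows. *)

#[local] Hint Extern 0 (is_true (@Order.le _ _ _ (_ + _)%R)) =>
  solve [exact: addr_ge0 | exact: adde_ge0] : core.
#[local] Hint Extern 0 (is_true (@Order.le _ _ _ (_ * _)%R)) =>
  solve [exact: mulr_ge0] : core.
#[local] Hint Extern 0 (is_true (@Order.le _ _ _ (expR _)%R)) =>
  solve [exact: expR_ge0] : core.
#[local] Hint Extern 0 (is_true (@Order.le _ _ _ (_%:E))) =>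
  solve [by rewrite lee_fin] : core.
#[local] Hint Extern 0 (is_true (@Order.le _ _ _ (_ * _)%E)) =>
  solve [exact: mule_ge0] : core.
#[local] Hint Extern 0 (is_true (@Order.le _ _ _ (if _ then _ else _))) =>
  solve [by case: ifP] : core.
#[local] Hint Extern 0 (is_true (@Order.le _ _ _ ((_ \*o _)%R _))) =>
  solve [exact: mulr_ge0] : core.
#[local] Hint Extern 0 (is_true (@Order.le _ _ _ ((_ \+ _)%R _))) =>
  solve [exact: addr_ge0] : core.
#[local] Hint Extern 0 (is_true (@Order.le _ _ _ ((_ \o _) _))) =>
  solve [by rewrite /=] : core.

(** * Weighted sums *)

Section ExtendedSums.
Context {R : realType}.
Local Open Scope ereal_scope.

Lemma esumZl (T : choiceType) (D : set T) (c : \bar R) (f : T -> \bar R) :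
  0 <= c -> (forall x, 0 <= f x) ->
  \esum_(x in D) (c * f x) = c * \esum_(x in D) f x.
Proof.
move=> c0 f0; case: c c0 => [c| |] // c0.
  rewrite /esum -ereal_supZl//; last first.
    by apply/set0P; exists 0, set0; [exact: fsets_set0|rewrite fsbig_set0].
  congr ereal_sup; apply/seteqP; split => [_ [X FX <-]|_ [_ [X FX <-] <-]] /=.
    by exists (\sum_(x \in X) f x); [exists X|rewrite ge0_mule_fsumr].
  by exists X => //; rewrite ge0_mule_fsumr.
have [fz|] := pselect (forall x, D x -> f x = 0).
  by rewrite !esum1 ?mule0// => x Dx; rewrite fz// mule0.
move/existsNP => [x /not_implyP[Dx /eqP fx]].
have fx_gt0 : 0 < f x by rewrite lt_def fx f0.
have term_le (h : T -> \bar R) : (forall y, 0 <= h y) -> h x <= \esum_(y in D) h y.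
  move=> h0; rewrite (esumID [set x])// setI1 mem_set// esum_set1// leeDl//.
  exact: esum_ge0.
rewrite [RHS]gt0_mulye; last exact: lt_le_trans fx_gt0 (term_le _ f0).
by apply/eqP; rewrite -leye_eq (le_trans _ (term_le (fun y => +oo * f y) _)) ?gt0_mulye.
Qed.

Lemma esum_pair (S T : choiceType) (f : S -> T -> \bar R) :
  (forall x y, 0 <= f x y) ->
  \esum_(x in [set: S]) \esum_(y in [set: T]) f x y =
  \esum_(p in [set: S * T]) f p.1 p.2.
Proof. by move=> f0; rewrite esum_esum//; congr esum; apply/seteqP; split. Qed.

Lemma esum_swap (S T : choiceType) (f : S -> T -> \bar R) :
  (forall x y, 0 <= f x y) ->
  \esum_(x in [set: S]) \esum_(y in [set: T]) f x y =
  \esum_(y in [set: T]) \esum_(x in [set: S]) f x y.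
Proof.
move=> f0; rewrite !esum_pair//.
rewrite (@reindex_esum _ _ _ [set: T * S] [set: S * T] (fun p => (p.2, p.1)))//.
split=> //; first by move=> [a b] [c e] _ _ /= [-> ->].
by move=> [a b] _; exists (b, a).
Qed.

Lemma esum_sumtype (Y Z : choiceType) (f : Y + Z -> \bar R) :
  (forall s, 0 <= f s) ->
  \esum_(s in [set: Y + Z]) f s =
  \esum_(y in [set: Y]) f (inl y) + \esum_(z in [set: Z]) f (inr z).
Proof.
move=> f0; rewrite (esumID (range inl))// !setTI.
rewrite (_ : ~` range inl = range inr); last first.
  apply/seteqP; split => -[y|z] /=; [by case; exists y|by exists z|by case|].
  by move=> _ [].
by rewrite !esum_image// => x y _ _ [].
Qed.

Lemma esum_restrict (T : choiceType) (A : set T) (f : T -> \bar R) :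
  (forall x, ~ A x -> f x = 0) ->
  \esum_(x in [set: T]) f x = \esum_(x in A) f x.
Proof.
move=> fA; rewrite [RHS]esum_mkcond; apply: eq_esum => x _.
by case: ifPn => //; rewrite notin_setE => /fA.
Qed.

Lemma esum_single (T : choiceType) (t : T) (f : T -> \bar R) : 0 <= f t ->
  (forall x, x != t -> f x = 0) -> \esum_(x in [set: T]) f x = f t.
Proof.
move=> f0 fn; rewrite (@esum_restrict _ [set t]) ?esum_set1// => x xt.
exact/fn/eqP.
Qed.

Lemma esum_tree (L : choiceType) (f : tree L -> \bar R) :
  (forall t, 0 <= f t) ->
  \esum_(t in [set: tree L]) f t =
  \esum_(x in [set: L]) \esum_(cs in [set: seq (tree L)]) f (Node x cs).
Proof.
move=> f0; rewrite esum_pair//.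
rewrite (@reindex_esum _ _ _ [set: L * seq (tree L)] [set: tree L]
  (fun p => Node p.1 p.2))//.
split=> //; first by move=> [a b] [c e] _ _ /= [-> ->].
by move=> [a b] _; exists (a, b).
Qed.

Lemma esum_size1 (T : choiceType) (f : seq T -> \bar R) : (forall l, 0 <= f l) ->
  \esum_(l in [set l | size l = 1%N]) f l = \esum_(x in [set: T]) f [:: x].
Proof.
move=> f0; apply: reindex_esum => //; split => //.
- by move=> x y _ _ [].
- by move=> [|x [|y l]] //= _; exists x.
Qed.

Lemma esum_expR (x : R) : (0 <= x)%R ->
  \esum_(n in [set: nat]) (n`!%:R^-1 * x ^+ n)%:E = (expR x)%:E.
Proof.
move=> x0; have term_ge0 n : (0 <= n`!%:R^-1 * x ^+ n)%R.
  by rewrite mulr_ge0 ?invr_ge0 ?exprn_ge0.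
rewrite -nneseries_esumT//.
rewrite expRE -EFin_lim; last first.
  rewrite /pseries/=; under eq_fun do rewrite mulrC.
  exact: is_cvg_series_exp_coeff.
by apply/congr_lim/funext => n/=; rewrite /pseries/= /series/= -sumEFin.
Qed.

Lemma adde_EFin_inj (x : \bar R) (p q : R) : p%:E + x = q%:E -> x = (q - p)%:E.
Proof. by case: x => [x| |] //= [<-]; rewrite addrAC subrr add0r. Qed.

End ExtendedSums.

Section WeightedSums.
Context {R : realType}.
Local Open Scope ereal_scope.

Definition wsum (T : choiceType) (w : T -> R) (F : T -> \bar R) : \bar R :=
  \esum_(x in [set: T]) ((w x)%:E * F x).

Definition mass (T : choiceType) (w : T -> R) : \bar R := wsum w (fun=> 1).

Section wsum_theory.
Variables (T : choiceType) (w : T -> R).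
Hypothesis w0 : forall x, (0 <= w x)%R.

Lemma wsum_ge0 (F : T -> \bar R) : (forall x, 0 <= F x) -> 0 <= wsum w F.
Proof. by move=> F0; apply: esum_ge0. Qed.

Lemma eq_wsum_support (F G : T -> \bar R) :
  (forall x, w x != 0%R -> F x = G x) -> wsum w F = wsum w G.
Proof.
move=> FG; apply: eq_esum => x _.
by have [->|/FG -> //] := eqVneq (w x) 0%R; rewrite !mul0e.
Qed.

Lemma eq_wsum (F G : T -> \bar R) : F =1 G -> wsum w F = wsum w G.
Proof. by move=> FG; apply: eq_wsum_support => x _; exact: FG. Qed.

Lemma wsum0 : wsum w (fun=> 0) = 0.
Proof. by apply: esum1 => x _; rewrite mule0. Qed.

Lemma wsumDr (F G : T -> \bar R) : (forall x, 0 <= F x) -> (forall x, 0 <= G x) ->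
  wsum w (fun x => F x + G x) = wsum w F + wsum w G.
Proof.
by move=> F0 G0; rewrite /wsum -esumD//; apply: eq_esum => x _; rewrite ge0_muleDr.
Qed.

Lemma wsumZr c (F : T -> \bar R) : 0 <= c -> (forall x, 0 <= F x) ->
  wsum w (fun x => c * F x) = c * wsum w F.
Proof.
by move=> c0 F0; rewrite /wsum -esumZl//; apply: eq_esum => x _; rewrite muleCA.
Qed.

Lemma wsum_cst c : 0 <= c -> wsum w (fun=> c) = c * mass w.
Proof. by move=> c0; rewrite -wsumZr//; apply: eq_wsum => x; rewrite mule1. Qed.

Lemma wsumDl (v : T -> R) (F : T -> \bar R) : (forall x, (0 <= v x)%R) ->
  (forall x, 0 <= F x) -> wsum (v \+ w)%R F = wsum v F + wsum w F.
Proof.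
move=> v0 F0; rewrite /wsum -esumD//.
by apply: eq_esum => x _; rewrite EFinD ge0_muleDl.
Qed.

Lemma wsumZl c (F : T -> \bar R) : (0 <= c)%R -> (forall x, 0 <= F x) ->
  wsum (c \*o w)%R F = c%:E * wsum w F.
Proof.
by move=> c0 F0; rewrite /wsum -esumZl//; apply: eq_esum => x _; rewrite EFinM muleA.
Qed.

Lemma massZ c : (0 <= c)%R -> mass (c \*o w)%R = c%:E * mass w.
Proof. by move=> c0; exact: wsumZl. Qed.

Lemma massD (v : T -> R) : (forall x, (0 <= v x)%R) ->
  mass (v \+ w)%R = mass v + mass w.
Proof. by move=> v0; exact: wsumDl. Qed.

Lemma wsum_swap (S : choiceType) (v : S -> R) (F : S -> T -> \bar R) :
  (forall y, (0 <= v y)%R) -> (forall y x, 0 <= F y x) ->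
  wsum v (fun y => wsum w (F y)) = wsum w (fun x => wsum v (F ^~ x)).
Proof.
move=> v0 F0; rewrite /wsum.
under eq_esum do rewrite -esumZl//.
under [RHS]eq_esum do rewrite -esumZl//.
by rewrite esum_swap//; apply: eq_esum => x _; apply: eq_esum => y _; rewrite muleCA.
Qed.

End wsum_theory.

Lemma wsum_delta (T : choiceType) (t : T) (F : T -> \bar R) : 0 <= F t ->
  wsum (fun x => (x == t)%:R) F = F t.
Proof.
move=> F0; rewrite /wsum (@esum_single _ _ t) ?eqxx ?mul1e//.
by move=> x /negbTE ->; rewrite mul0e.
Qed.

Lemma wsum_nil (T : choiceType) (w : seq T -> R) (F : seq T -> \bar R) :
  (forall l, (0 <= w l)%R) -> (forall l, 0 <= F l) ->
  wsum w F = (w [::])%:E * F [::] + wsum w (fun l => if nilp l then 0 else F l).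
Proof.
move=> w0 F0; rewrite /wsum (esumID [set [::]])// !setTI esum_set1//; congr (_ + _).
rewrite [RHS](@esum_restrict _ _ (~` [set [::]])).
  by apply: eq_esum => -[/(_ erefl)|x l].
by move=> l /contrapT ->; rewrite mule0.
Qed.

Lemma wsum_size1 (T : choiceType) (w : seq T -> R) (F : seq T -> \bar R) :
  (forall l, (0 <= w l)%R) -> (forall l, 0 <= F l) ->
  wsum w F = wsum w (fun l => if size l == 1%N then 0 else F l) +
             wsum (fun x => w [:: x]) (fun x => F [:: x]).
Proof.
move=> w0 F0; rewrite /wsum (esumID [set l | size l = 1%N])// !setTI addeC.
congr (_ + _); last exact: (@esum_size1 _ _ (fun l => (w l)%:E * F l)).
rewrite [RHS](@esum_restrict _ _ (~` [set l | size l = 1%N])).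
  by apply: eq_esum => l /= /eqP/negbTE ->.
by move=> l /contrapT /= ->; rewrite mule0.
Qed.

End WeightedSums.

#[local] Hint Extern 0 (is_true (@Order.le _ _ _ (wsum _ _))) =>
  solve [exact: wsum_ge0] : core.

(** * Poisson processes *)

Section IteratedSums.
Context {R : realType}.
Local Open Scope ereal_scope.

Fixpoint wsumn (T : choiceType) (w : T -> R) n (F : seq T -> \bar R) : \bar R :=
  if n is n'.+1 then wsum w (fun x => wsumn w n' (fun l => F (x :: l)))
  else F [::].

Section wsumn_theory.
Variables (T : choiceType) (w : T -> R).
Hypothesis w0 : forall x, (0 <= w x)%R.

Lemma wsumn_ge0 n (F : seq T -> \bar R) : (forall l, 0 <= F l) -> 0 <= wsumn w n F.
Proof. by elim: n F => //= n IH F F0; apply: wsum_ge0 => // x; exact: IH. Qed.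

Lemma eq_wsumn n (F G : seq T -> \bar R) : F =1 G -> wsumn w n F = wsumn w n G.
Proof. by move=> /funext ->. Qed.

Lemma wsumnE n (F : seq T -> \bar R) : (forall l, 0 <= F l) ->
  wsumn w n F =
  \esum_(l in [set l | size l = n]) ((\prod_(x <- l) w x)%:E * F l).
Proof.
have prod0 l : (0 <= \prod_(x <- l) w x)%R by exact: prodr_ge0.
elim: n F => [|n IH] F F0 /=.
  rewrite (_ : [set l | _] = [set [::]]) ?esum_set1 ?big_nil ?mul1e//.
  by apply/seteqP; split => l /=; [move/size0nil|move=> ->].
under eq_wsum do rewrite IH//.
rewrite /wsum; under eq_esum do rewrite -esumZl//.
rewrite esum_esum//.
rewrite (@reindex_esum _ _ _ ([set: T] `*`` (fun=> [set l | size l = n]))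
  [set l | size l = n.+1] (fun p => p.1 :: p.2))//.
  by apply: eq_esum => -[x l] _; rewrite /= big_cons EFinM muleA.
split=> //.
- by move=> [a b] [_ /= ->].
- by move=> [a b] [c e] _ _ /= [-> ->].
- by move=> [//|a b] /= [sb]; exists (a, b).
Qed.

Lemma wsumn_cst n (m : R) (c : \bar R) : mass w = m%:E -> 0 <= c ->
  wsumn w n (fun=> c) = (m ^+ n)%:E * c.
Proof.
move=> wm c0; elim: n => /= [|n IH]; first by rewrite mul1e.
have cn0 : 0 <= wsumn w n (fun=> c) by exact: wsumn_ge0.
by rewrite wsum_cst// wm IH muleAC -EFinM exprSr.
Qed.

Lemma wsum_wsumn n (S : choiceType) (v : S -> R) (F : S -> seq T -> \bar R) :
  (forall y, (0 <= v y)%R) -> (forall y l, 0 <= F y l) ->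
  wsum v (fun y => wsumn w n (F y)) = wsumn w n (fun l => wsum v (F ^~ l)).
Proof.
move=> v0; elim: n F => //= n IH F F0.
rewrite wsum_swap//; last by move=> y x; exact: wsumn_ge0.
by apply: eq_wsum => x; rewrite (IH (fun y l => F y (x :: l))).
Qed.

End wsumn_theory.
End IteratedSums.

#[local] Hint Extern 0 (is_true (@Order.le _ _ _ (wsumn _ _ _))) =>
  solve [exact: wsumn_ge0] : core.

Section PoissonLaw.
Context {R : realType}.
Local Open Scope ereal_scope.

Definition inv_fact (n : nat) : R := (n`!%:R^-1)%R.

Lemma inv_fact_ge0 n : (0 <= inv_fact n)%R.
Proof. by rewrite invr_ge0. Qed.
#[local] Hint Resolve inv_fact_ge0 : core.

Definition poisson_weight (T : choiceType) (w : T -> R) (l : seq T) : R :=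
  (inv_fact (size l) * \prod_(x <- l) w x)%R.

(* The law of a Poisson process of intensity [w], its points being listed in a
   uniformly random order. *)
Definition poisson_law (T : choiceType) (w : T -> R) : seq T -> R :=
  (expR (- fine (mass w)) \*o poisson_weight w)%R.

Section poisson_law_theory.
Variables (T : choiceType) (w : T -> R).
Hypothesis w0 : forall x, (0 <= w x)%R.

Lemma poisson_weight_ge0 l : (0 <= poisson_weight w l)%R.
Proof. by rewrite mulr_ge0 ?prodr_ge0. Qed.

Lemma poisson_law_ge0 l : (0 <= poisson_law w l)%R.
Proof. by rewrite mulr_ge0 ?expR_ge0 ?poisson_weight_ge0. Qed.

Lemma wsum_poisson_weight (F : seq T -> \bar R) : (forall l, 0 <= F l) ->
  wsum (poisson_weight w) F = wsum inv_fact (fun n => wsumn w n F).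
Proof.
move=> F0; have prod0 l : (0 <= \prod_(x <- l) w x)%R by exact: prodr_ge0.
have F1 l : 0 <= (poisson_weight w l)%:E * F l.
  by rewrite mule_ge0 ?lee_fin ?poisson_weight_ge0.
rewrite /wsum; under [RHS]eq_esum do rewrite wsumnE// -esumZl//.
rewrite (_ : [set: seq T] = \bigcup_n [set l | size l = n]); last first.
  by apply/seteqP; split => // l _; exists (size l).
rewrite esum_bigcupT//; last by move=> i j _ _ [l [/= <- <-]].
by apply: eq_esum => n _; apply: eq_esum => l /= <-; rewrite muleA -EFinM.
Qed.

Lemma wsum_poisson (F : seq T -> \bar R) : (forall l, 0 <= F l) ->
  wsum (poisson_law w) F =
  (expR (- fine (mass w)))%:E * wsum (poisson_weight w) F.
Proof. by move=> F0; rewrite wsumZl//; exact: poisson_weight_ge0. Qed.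

Lemma mass_poisson_weight (m : R) : mass w = m%:E ->
  mass (poisson_weight w) = (expR m)%:E.
Proof.
move=> wm; have m0 : (0 <= m)%R by rewrite -lee_fin -wm wsum_ge0.
rewrite /mass wsum_poisson_weight// -esum_expR//; apply: eq_esum => n _.
by rewrite (wsumn_cst _ _ wm)// mule1.
Qed.

Lemma mass_poisson_law (m : R) : mass w = m%:E -> mass (poisson_law w) = 1.
Proof.
move=> wm; rewrite [mass _]wsum_poisson// [wsum _ _](mass_poisson_weight wm).
by rewrite wm -EFinM -expRD addNr expR0.
Qed.

Lemma poisson_law_nil : poisson_law w [::] = expR (- fine (mass w)).
Proof. by rewrite /poisson_law /= /poisson_weight /inv_fact big_nil invr1 !mulr1. Qed.

Lemma poisson_law1 x : poisson_law w [:: x] = (expR (- fine (mass w)) * w x)%R.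
Proof. by rewrite /poisson_law /= /poisson_weight /inv_fact big_seq1 invr1 mul1r. Qed.

Lemma poisson_law_support l : poisson_law w l != 0%R -> all (fun x => w x != 0%R) l.
Proof.
apply: contraNT => /allPn[x xl /negbNE/eqP wx].
by rewrite /poisson_law /= /poisson_weight (big_rem x)//= wx mul0r !mulr0.
Qed.

Lemma wsum_poisson_nilp (m : R) (a b : \bar R) : mass w = m%:E ->
  0 <= a -> 0 <= b ->
  wsum (poisson_law w) (fun l => if nilp l then a else b) =
  (expR (- m))%:E * a + (1 - expR (- m))%:E * b.
Proof.
move=> wm a0 b0; have P0 := poisson_law_ge0.
have split_nil := wsum_nil P0; rewrite split_nil//= poisson_law_nil wm.
congr (_ + _).
rewrite (_ : (1 - expR (- m))%:E =
    wsum (poisson_law w) (fun l => if nilp l then 0 else 1)).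
  by rewrite muleC -wsumZr//; apply: eq_wsum => l; case: nilp; rewrite ?mule1 ?mule0.
apply/esym/adde_EFin_inj; rewrite -[RHS](mass_poisson_law wm) [RHS]split_nil//.
by rewrite poisson_law_nil wm mule1.
Qed.

Lemma wsum_poisson_size1 (m : R) (F : seq T -> \bar R) : mass w = m%:E ->
  (forall l, 0 <= F l) ->
  wsum (poisson_law w) F =
  wsum (poisson_law w) (fun l => if size l == 1%N then 0 else F l) +
  (expR (- m))%:E * wsum w (fun x => F [:: x]).
Proof.
move=> wm F0; rewrite (wsum_size1 poisson_law_ge0)// -wsumZl//; congr (_ + _).
by apply: eq_esum => x _; rewrite poisson_law1 wm.
Qed.

End poisson_law_theory.
End PoissonLaw.

#[local] Hint Extern 0 (is_true (@Order.le _ _ _ (inv_fact _))) =>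
  solve [exact: inv_fact_ge0] : core.
#[local] Hint Extern 0 (is_true (@Order.le _ _ _ (poisson_law _ _))) =>
  solve [exact: poisson_law_ge0] : core.

Section PoissonProcess.
Context {R : realType}.
Local Open Scope ereal_scope.

Section Mapping.
Variables (X Y : choiceType) (w : X -> R) (w' : Y -> R) (g : X -> Y).
Variable e : Y -> Y -> Prop.
Hypothesis w0 : forall x, (0 <= w x)%R.
Hypothesis w'0 : forall y, (0 <= w' y)%R.
Hypothesis wg : forall f : Y -> \bar R, (forall y, 0 <= f y) ->
  (forall y y', e y y' -> f y = f y') -> wsum w (f \o g) = wsum w' f.

Lemma wsumn_map n (F : seq Y -> \bar R) : (forall l, 0 <= F l) ->
  (forall l1 y y' l2, e y y' -> F (l1 ++ y :: l2) = F (l1 ++ y' :: l2)) ->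
  wsumn w n (F \o map g) = wsumn w' n F.
Proof.
elim: n F => //= n IH F F0 Fe.
under eq_wsum => x.
  rewrite (IH (fun l => F (g x :: l)))//; last by move=> l1; exact: (Fe (g x :: l1)).
  over.
rewrite (@wg (fun y => wsumn w' n (fun l => F (y :: l))))// => y y' yy.
by apply: eq_wsumn => l; exact: (Fe [::]).
Qed.

Lemma wsum_poisson_map (F : seq Y -> \bar R) : (forall l, 0 <= F l) ->
  (forall l1 y y' l2, e y y' -> F (l1 ++ y :: l2) = F (l1 ++ y' :: l2)) ->
  wsum (poisson_law w) (F \o map g) = wsum (poisson_law w') F.
Proof.
move=> F0 Fe; rewrite !wsum_poisson//.
rewrite (_ : mass w = mass w'); last exact: (wg (f := fun=> 1)).
rewrite !wsum_poisson_weight//.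
by congr (_ * _); apply: eq_wsum => n; rewrite wsumn_map.
Qed.

End Mapping.

Fixpoint binomial_conv n (K : nat -> nat -> \bar R) : \bar R :=
  if n is n'.+1 then
    binomial_conv n' (fun i j => K i.+1 j) + binomial_conv n' (fun i j => K i j.+1)
  else K 0%N 0%N.

Lemma binomial_conv_ge0 n K : (forall i j, 0 <= K i j) -> 0 <= binomial_conv n K.
Proof. by elim: n K => //= n IH K K0; rewrite adde_ge0 ?IH. Qed.

Lemma eq_binomial_conv n K K' :
  (forall i j, K i j = K' i j) -> binomial_conv n K = binomial_conv n K'.
Proof.
by move=> KK; congr binomial_conv; apply/funext => i; apply/funext => j.
Qed.

Lemma wsum_binomial_conv n (T : choiceType) (w : T -> R)
    (K : T -> nat -> nat -> \bar R) :
  (forall x, (0 <= w x)%R) -> (forall x i j, 0 <= K x i j) ->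
  wsum w (fun x => binomial_conv n (K x)) =
  binomial_conv n (fun i j => wsum w (fun x => K x i j)).
Proof.
move=> w0; elim: n K => //= n IH K K0.
rewrite wsumDr//; [|by move=> x; exact: binomial_conv_ge0..].
by rewrite (IH (fun x i j => K x i.+1 j))// (IH (fun x i j => K x i j.+1)).
Qed.

Lemma binomial_convE n (K : nat -> nat -> \bar R) : (forall i j, 0 <= K i j) ->
  binomial_conv n K = \sum_(0 <= i < n.+1) ('C(n, i)%:R%:E * K i (n - i)%N).
Proof.
elim: n K => [|n IH] K K0 /=; first by rewrite big_nat1 bin0 mul1e.
rewrite !IH// [RHS]big_nat_recl//= bin0 mul1e subn0.
under [in RHS]eq_bigr => i _ do rewrite binS natrD EFinD ge0_muleDl// subSS.
rewrite big_split/= addeA addeC; congr (_ + _).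
rewrite [in RHS]big_nat_recr//= bin_small// mul0e adde0.
rewrite [in LHS]big_nat_recl//= bin0 mul1e subn0; congr (_ + _).
by apply: eq_big_nat => i /andP[_ ni]; rewrite subnSK.
Qed.

Lemma binomial_inv_fact n i : (i <= n)%N ->
  ('C(n, i)%:R * inv_fact n = inv_fact i * inv_fact (n - i) :> R)%R.
Proof.
move=> ni; rewrite /inv_fact -(bin_fact ni) !natrM.
have fact_neq0 (m : nat) : (m`!%:R : R) != 0%R by rewrite pnatr_eq0 -lt0n fact_gt0.
have bin_neq0 : ('C(n, i)%:R : R) != 0%R by rewrite pnatr_eq0 -lt0n bin_gt0.
by field; rewrite !fact_neq0 bin_neq0.
Qed.

Lemma wsum_inv_fact_binomial_conv (K : nat -> nat -> \bar R) :
  (forall i j, 0 <= K i j) ->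
  wsum inv_fact (fun n => binomial_conv n K) =
  wsum inv_fact (fun i => wsum inv_fact (K i)).
Proof.
move=> K0; pose f i j := (inv_fact i)%:E * ((inv_fact j)%:E * K i j).
have f0 i j : 0 <= f i j by rewrite /f.
transitivity (\esum_(n in [set: nat]) \esum_(i in `I_n.+1) f i (n - i)%N).
  apply: eq_esum => n _.
  rewrite binomial_convE// ge0_sume_distrr// esum_fset//.
  rewrite big_mkord -fsbig_ord; apply: eq_bigr => i _.
  by rewrite /f !muleA -!EFinM mulrC binomial_inv_fact ?(ltnSE (ltn_ord i)).
under [RHS]eq_wsum do rewrite /wsum.
rewrite /wsum; under [RHS]eq_esum do rewrite -esumZl//.
rewrite esum_esum// [RHS]esum_pair//.
rewrite (@reindex_esum _ _ _ [set: nat * nat]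
  ([set: nat] `*`` (fun n => `I_n.+1)) (fun p => (p.1 + p.2, p.1)%N)).
  by apply: eq_esum => -[i j] _ /=; rewrite addKn.
split.
- by move=> [i j] _; split => //=; rewrite ltnS leq_addr.
- by move=> [i j] [i' j'] _ _ /= [] + ii; rewrite ii => /addnI ->.
- by move=> [n i] [_ /= ni]; exists (i, n - i)%N => //=; rewrite subnKC.
Qed.

Definition lefts (Y Z : Type) : seq (Y + Z) -> seq Y :=
  pmap (fun s => if s is inl y then Some y else None).

Definition rights (Y Z : Type) : seq (Y + Z) -> seq Z :=
  pmap (fun s => if s is inr z then Some z else None).

Section Colouring.
Variables (Y Z : choiceType) (u : Y + Z -> R).
Hypothesis u0 : forall s, (0 <= u s)%R.

Let inl_ge0 y : (0 <= (u \o inl) y)%R. Proof. exact: u0. Qed.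

Let inr_ge0 z : (0 <= (u \o inr) z)%R. Proof. exact: u0. Qed.

Lemma wsum_sumtype (F : Y + Z -> \bar R) : (forall s, 0 <= F s) ->
  wsum u F = wsum (u \o inl) (F \o inl) + wsum (u \o inr) (F \o inr).
Proof. by move=> F0; rewrite /wsum esum_sumtype. Qed.

Lemma wsumn_colour n (G : seq Y -> seq Z -> \bar R) : (forall l1 l2, 0 <= G l1 l2) ->
  wsumn u n (fun l => G (lefts l) (rights l)) =
  binomial_conv n (fun i j => wsumn (u \o inl) i (fun l1 => wsumn (u \o inr) j (G l1))).
Proof.
elim: n G => //= n IH G G0.
rewrite wsum_sumtype//; congr (_ + _).
  under eq_wsum => y do rewrite /= (IH (fun l1 => G (y :: l1)))//.
  by rewrite wsum_binomial_conv.
under eq_wsum => z do rewrite /= (IH (fun l1 l2 => G l1 (z :: l2)))//.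
rewrite wsum_binomial_conv//.
apply: eq_binomial_conv => i j.
by rewrite (wsum_wsumn _ _ (F := fun z l1 => wsumn _ j (fun l2 => G l1 (z :: l2)))).
Qed.

Lemma wsum_poisson_colour (m m' : R) (G : seq Y -> seq Z -> \bar R) :
  mass (u \o inl) = m%:E -> mass (u \o inr) = m'%:E ->
  (forall l1 l2, 0 <= G l1 l2) ->
  wsum (poisson_law u) (fun l => G (lefts l) (rights l)) =
  wsum (poisson_law (u \o inl)) (fun l1 => wsum (poisson_law (u \o inr)) (G l1)).
Proof.
move=> um um' G0.
have WZ := poisson_weight_ge0 inr_ge0.
rewrite !wsum_poisson//.
under [in RHS]eq_wsum do rewrite wsum_poisson//.
rewrite wsumZr//; last exact: poisson_weight_ge0.
have -> : mass u = (m + m')%:E by rewrite EFinD -um -um' [mass u]wsum_sumtype.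
rewrite um um' muleA -EFinM -expRD -opprD; congr (_ * _).
rewrite !wsum_poisson_weight//.
under eq_wsum do rewrite wsumn_colour//.
rewrite wsum_inv_fact_binomial_conv//; apply: eq_wsum => i.
under [RHS]eq_wsumn do rewrite wsum_poisson_weight//.
exact: wsum_wsumn.
Qed.

End Colouring.

Lemma perm_lefts_rights (T : eqType) (l : seq (T + T)) :
  perm_eq (map (fun s => match s with inl x | inr x => x end) l) (lefts l ++ rights l).
Proof.
elim: l => //= -[x|x] l IH /=; first by rewrite perm_cons.
by rewrite perm_sym -cat1s perm_catCA/= perm_cons perm_sym.
Qed.

Lemma wsum_poisson_superpose (T : choiceType) (v w : T -> R) (m m' : R)
    (G : seq T -> \bar R) :
  (forall x, (0 <= v x)%R) -> (forall x, (0 <= w x)%R) ->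
  mass v = m%:E -> mass w = m'%:E ->
  (forall l, 0 <= G l) -> (forall l l', perm_eq l l' -> G l = G l') ->
  wsum (poisson_law v) (fun l1 => wsum (poisson_law w) (fun l2 => G (l1 ++ l2))) =
  wsum (poisson_law (v \+ w)%R) G.
Proof.
move=> v0 w0 vm wm G0 Gp.
pose u (s : T + T) := match s with inl x => v x | inr x => w x end.
have u0 s : (0 <= u s)%R by case: s.
rewrite -(wsum_poisson_colour u0 vm wm (G := fun l1 l2 => G (l1 ++ l2)))//.
under eq_wsum do rewrite -(Gp _ _ (perm_lefts_rights _)).
apply: (wsum_poisson_map (e := eq)) => //; last by move=> l1 y _ l2 <-.
by move=> f f0 _; rewrite wsum_sumtype ?wsumDl.
Qed.

Section Thinning.
Variables (X Y : choiceType) (w : X -> R) (w' : Y -> R) (g : X -> option Y).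
Variables (e : Y -> Y -> Prop) (m r : R).
Hypothesis w0 : forall x, (0 <= w x)%R.
Hypothesis w'0 : forall y, (0 <= w' y)%R.
Hypothesis w'm : mass w' = m%:E.
Hypothesis kept : forall f : Y -> \bar R, (forall y, 0 <= f y) ->
  (forall y y', e y y' -> f y = f y') ->
  wsum w (fun x => if g x is Some y then f y else 0) = wsum w' f.
Hypothesis deleted : wsum w (fun x => if g x is Some _ then 0 else 1) = r%:E.

Let colour x : Y + unit := if g x is Some y then inl y else inr tt.

Let intensity (s : Y + unit) : R := match s with inl y => w' y | inr _ => r end.

Let colour_rel (s s' : Y + unit) : Prop := match s, s' with
  | inl y, inl y' => e y y' | inr _, inr _ => True | _, _ => False end.

Let r0 : (0 <= r)%R.
Proof. by rewrite -lee_fin -deleted; apply: wsum_ge0 => // x; case: (g x). Qed.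

Let intensity_ge0 s : (0 <= intensity s)%R. Proof. by case: s. Qed.

Let deleted_mass : mass (intensity \o inr) = r%:E.
Proof. by rewrite /mass /wsum (@esum_single _ _ tt) ?mule1// => -[]. Qed.

Lemma wsum_thin_colour (f : Y + unit -> \bar R) : (forall s, 0 <= f s) ->
  (forall s s', colour_rel s s' -> f s = f s') ->
  wsum w (f \o colour) = wsum intensity f.
Proof.
move=> f0 fe.
rewrite wsum_sumtype// -kept//; last by move=> y y' yy; exact: fe.
rewrite (@eq_wsum _ _ _ (f \o inr) (fun=> f (inr tt))); last by case.
rewrite wsum_cst// deleted_mass -deleted -wsumZr//; last by move=> x; case: (g x).
rewrite -wsumDr//; [|by move=> x; case: (g x) => /=..].
by apply: eq_wsum => x; rewrite /colour/=; case: (g x) => [y|];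
  rewrite ?mule0 ?mule1 ?adde0 ?add0e.
Qed.

Lemma wsum_poisson_thin (G : bool -> seq Y -> \bar R) : (forall j l, 0 <= G j l) ->
  (forall j l1 y y' l2, e y y' -> G j (l1 ++ y :: l2) = G j (l1 ++ y' :: l2)) ->
  wsum (poisson_law w) (fun l => G (has (fun x => ~~ g x) l) (pmap g l)) =
  (expR (- r))%:E * wsum (poisson_law w') (G false) +
  (1 - expR (- r))%:E * wsum (poisson_law w') (G true).
Proof.
move=> G0 Ge; pose H (l : seq (Y + unit)) := G (~~ nilp (rights l)) (lefts l).
have H0 l : 0 <= H l by exact: G0.
transitivity (wsum (poisson_law w) (H \o map colour)).
  by apply: eq_wsum => l; rewrite /H /=; congr G;
    elim: l => //= x l ->; rewrite /colour; case: (g x).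
rewrite (wsum_poisson_map w0 intensity_ge0 wsum_thin_colour)//; last first.
  move=> l1 s s' l2; rewrite /H /lefts /rights !pmap_cat /nilp !size_cat.
  by case: s => [y|[]]; case: s' => [y'|[]] //=; exact: Ge.
rewrite (wsum_poisson_colour intensity_ge0 w'm deleted_mass
  (G := fun l1 l2 => G (~~ nilp l2) l1))//.
under eq_wsum => l1.
  rewrite (eq_wsum _ (G := fun l2 => if nilp l2 then G false l1 else G true l1)).
    rewrite (wsum_poisson_nilp _ deleted_mass)//; over.
  by move=> l2; case: nilp.
have r1 : (0 <= 1 - expR (- r))%R by rewrite subr_ge0 expR_le1 oppr_le0.
by rewrite wsumDr ?wsumZr.
Qed.

End Thinning.
End PoissonProcess.

(** * Expectations over broadcast trees *)

Lemma broadcast_pmf_ge0 (R : realType) (a b : R) d s t : 0 <= broadcast_pmf a b d s t.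
Proof.
elim: d s t => [|d IH] s t /=; first exact: ler0n.
case: t => x cs; case: ifP => // _.
by rewrite !mulr_ge0 ?poisson_pmf_ge0// prodr_ge0.
Qed.

#[local] Hint Extern 0 (is_true (@Order.le _ _ _ (broadcast_pmf _ _ _ _ _))) =>
  solve [exact: broadcast_pmf_ge0] : core.

Section BroadcastExpectation.
Context {R : realType}.
Local Open Scope ereal_scope.

Lemma broadcast_pmf_root (a b : R) d s t :
  broadcast_pmf a b d s t != 0%R -> root_label t = s.
Proof.
apply: contraNeq; case: d t => [|d] [x cs] /= xs; last by rewrite (negbTE xs).
by rewrite (_ : (_ == Node _ _) = false)//; apply: contraNF xs => /eqP[->].
Qed.

Definition own_opp_forests (s : bool) : set (seq (tree bool) * seq (tree bool)) :=
  [set p | all (fun c => root_label c == s) p.1 &&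
           all (fun c => root_label c == ~~ s) p.2].

Lemma filter_other_label s (l : seq (tree bool)) :
  all (fun c => root_label c == ~~ s) l -> [seq c <- l | root_label c == s] = [::].
Proof. by elim: l => //= c l IH /andP[/eqP-> /IH->]; case: (s). Qed.

Lemma filter_own s (l1 l2 : seq (tree bool)) : own_opp_forests s (l1, l2) ->
  [seq c <- l1 ++ l2 | root_label c == s] = l1.
Proof.
move=> /andP[/= /all_filterP own opp].
by rewrite filter_cat own filter_other_label// cats0.
Qed.

Lemma filter_opp s (l1 l2 : seq (tree bool)) : own_opp_forests s (l1, l2) ->
  [seq c <- l1 ++ l2 | root_label c == ~~ s] = l2.
Proof.
move=> /andP[/= own /all_filterP opp].
by rewrite filter_cat opp filter_other_label ?negbK.
Qed.

Lemma esum_own_opp_forests s (f : seq (tree bool) -> \bar R) :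
  (forall cs, cs != [seq c <- cs | root_label c == s] ++
                    [seq c <- cs | root_label c == ~~ s] -> f cs = 0) ->
  \esum_(cs in [set: seq (tree bool)]) f cs =
  \esum_(p in own_opp_forests s) f (p.1 ++ p.2).
Proof.
move=> fB.
pose B := [set cs : seq (tree bool) | cs =
  [seq c <- cs | root_label c == s] ++ [seq c <- cs | root_label c == ~~ s]].
rewrite (@esum_restrict _ _ B); last by move=> cs /eqP; exact: fB.
apply: reindex_esum; split.
- by move=> [l1 l2] lA; rewrite /B/= filter_own// filter_opp.
- move=> [l1 l2] [k1 k2]; rewrite !inE => lA kA /= lk; congr (_, _).
    by rewrite -(filter_own lA) lk filter_own.
  by rewrite -(filter_opp lA) lk filter_opp.
- move=> cs csB; exists ([seq c <- cs | root_label c == s],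
    [seq c <- cs | root_label c == ~~ s]); last exact: esym.
  by rewrite /own_opp_forests/= !filter_all.
Qed.

Lemma poisson_lawZ (T : choiceType) (w : T -> R) (r : R) l : mass w = 1 ->
  (forall x, 0 <= w x)%R -> (0 < r)%R ->
  poisson_law (r \*o w)%R l = (poisson_pmf r (size l) * \prod_(x <- l) w x)%R.
Proof.
move=> wm w0 r0; rewrite /poisson_law /poisson_weight /inv_fact /poisson_pmf r0/=.
rewrite massZ ?wm ?mule1 ?(ltW r0)//=.
rewrite big_split/= big_const_seq count_predT -Monoid.iteropE/=.
by rewrite -[iterop _ _ _ _]/(r ^+ size l)%R; ring.
Qed.

Section OffspringLaw.
Variables a b : R.
Hypotheses (a0 : (0 < a)%R) (b0 : (0 < b)%R).

Let a20 : (0 < a / 2)%R. Proof. by rewrite divr_gt0. Qed.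
Let b20 : (0 < b / 2)%R. Proof. by rewrite divr_gt0. Qed.

Definition own_intensity d s : tree bool -> R := (a / 2 \*o broadcast_pmf a b d s)%R.
Definition opp_intensity d s : tree bool -> R :=
  (b / 2 \*o broadcast_pmf a b d (~~ s))%R.

Lemma own_intensity_ge0 d s t : (0 <= own_intensity d s t)%R.
Proof. by rewrite mulr_ge0// ltW. Qed.

Lemma opp_intensity_ge0 d s t : (0 <= opp_intensity d s t)%R.
Proof. by rewrite mulr_ge0// ltW. Qed.
#[local] Hint Resolve own_intensity_ge0 opp_intensity_ge0 : core.

Lemma own_intensity_root d s t : own_intensity d s t != 0%R -> root_label t = s.
Proof. by rewrite mulf_eq0 negb_or => /andP[_ /broadcast_pmf_root]. Qed.

Lemma opp_intensity_root d s t : opp_intensity d s t != 0%R -> root_label t = ~~ s.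
Proof. by rewrite mulf_eq0 negb_or => /andP[_ /broadcast_pmf_root]. Qed.

Lemma broadcast_pmfS d s (l1 l2 : seq (tree bool)) :
  (forall x, mass (broadcast_pmf a b d x) = 1) -> own_opp_forests s (l1, l2) ->
  broadcast_pmf a b d.+1 s (Node s (l1 ++ l2)) =
  (poisson_law (own_intensity d s) l1 * poisson_law (opp_intensity d s) l2)%R.
Proof.
move=> bm lA.
rewrite /= (filter_own lA) (filter_opp lA) !eqxx/=.
by rewrite /own_intensity /opp_intensity !poisson_lawZ.
Qed.

Lemma wsum_broadcast_of_mass d s (F : tree bool -> \bar R) :
  (forall x, mass (broadcast_pmf a b d x) = 1) -> (forall t, 0 <= F t) ->
  wsum (broadcast_pmf a b d.+1 s) F =
  wsum (poisson_law (own_intensity d s)) (fun l1 =>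
    wsum (poisson_law (opp_intensity d s)) (fun l2 => F (Node s (l1 ++ l2)))).
Proof.
move=> bm F0; rewrite /wsum esum_tree; last first.
  by move=> t; rewrite mule_ge0// lee_fin broadcast_pmf_ge0.
rewrite (@esum_single _ _ s); last 2 first.
- by apply: esum_ge0 => cs _; rewrite mule_ge0// lee_fin broadcast_pmf_ge0.
- move=> x xs; apply: esum1 => cs _.
  have [->|/broadcast_pmf_root/= xE] :=
    eqVneq (broadcast_pmf a b d.+1 s (Node x cs)) 0%R; first by rewrite mul0e.
  by rewrite xE eqxx in xs.
rewrite (@esum_own_opp_forests s); last first.
  by move=> cs /negbTE/= ->; rewrite eqxx mul0e.
under [RHS]eq_esum do rewrite -esumZl//.
rewrite [RHS]esum_pair// [RHS](@esum_restrict _ _ (own_opp_forests s)).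
  by apply: eq_esum => -[l1 l2] lA; rewrite broadcast_pmfS// muleA -EFinM.
move=> [l1 l2] /negP nA /=; rewrite muleA -EFinM (_ : _ * _ = 0)%R ?mul0e//.
apply: contraNeq nA; rewrite mulf_eq0 negb_or.
move=> /andP[/poisson_law_support own /poisson_law_support opp].
apply/andP; split; [apply: sub_all own|apply: sub_all opp] => c /=.
  by move=> /own_intensity_root ->.
by move=> /opp_intensity_root ->.
Qed.

Lemma mass_broadcast d s : mass (broadcast_pmf a b d s) = 1.
Proof.
elim: d s => [|d IH] s; first exact: (@wsum_delta _ _ (Node s [::]) (fun=> 1)).
have own_mass : mass (own_intensity d s) = (a / 2)%:E by rewrite massZ ?IH ?mule1 ?ltW.
have opp_mass : mass (opp_intensity d s) = (b / 2)%:E by rewrite massZ ?IH ?mule1 ?ltW.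
rewrite [mass _]wsum_broadcast_of_mass//.
under eq_wsum do rewrite [wsum _ _](mass_poisson_law _ opp_mass)//.
exact: mass_poisson_law own_mass.
Qed.

Lemma mass_own_intensity d s : mass (own_intensity d s) = (a / 2)%:E.
Proof. by rewrite massZ ?mass_broadcast ?mule1 ?ltW. Qed.

Lemma mass_opp_intensity d s : mass (opp_intensity d s) = (b / 2)%:E.
Proof. by rewrite massZ ?mass_broadcast ?mule1 ?ltW. Qed.

Lemma wsum_broadcast d s (F : tree bool -> \bar R) : (forall t, 0 <= F t) ->
  wsum (broadcast_pmf a b d.+1 s) F =
  wsum (poisson_law (own_intensity d s)) (fun l1 =>
    wsum (poisson_law (opp_intensity d s)) (fun l2 => F (Node s (l1 ++ l2)))).
Proof. by move=> F0; rewrite wsum_broadcast_of_mass//; exact: mass_broadcast. Qed.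

Lemma wsum_broadcast_sym d s (F : tree bool -> \bar R) : (forall t, 0 <= F t) ->
  (forall l l', perm_eq l l' -> F (Node s l) = F (Node s l')) ->
  wsum (broadcast_pmf a b d.+1 s) F =
  wsum (poisson_law (own_intensity d s \+ opp_intensity d s)%R) (F \o Node s).
Proof.
move=> F0 Fp; rewrite wsum_broadcast//.
by rewrite -(wsum_poisson_superpose _ _ (mass_own_intensity d s)
  (mass_opp_intensity d s)).
Qed.

End OffspringLaw.
End BroadcastExpectation.

#[local] Hint Extern 0 (is_true (@Order.le _ _ _ (own_intensity _ _ _ _ _))) =>
  solve [exact: own_intensity_ge0] : core.
#[local] Hint Extern 0 (is_true (@Order.le _ _ _ (opp_intensity _ _ _ _ _))) =>
  solve [exact: opp_intensity_ge0] : core.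

(** * The cutting adversary *)

Section TreeIso.
Variable L : eqType.

Fixpoint tree_iso_refl (t : tree L) : tree_iso t t.
Proof.
case: t => x cs; constructor; elim: cs => [|c cs IH]; first by constructor.
exact: (@ForestIsoCons _ c c cs [::] cs).
Qed.

Lemma forest_iso_refl (cs : seq (tree L)) : forest_iso cs cs.
Proof.
elim: cs => [|c cs IH]; first by constructor.
exact: (@ForestIsoCons _ c c cs [::] cs (tree_iso_refl c)).
Qed.

Lemma tree_iso_perm x (l l' : seq (tree L)) :
  perm_eq l l' -> tree_iso (Node x l) (Node x l').
Proof.
move=> ll; constructor; elim: l l' ll => [|c l IH] l' ll.
  by move: ll; rewrite perm_sym => /perm_nilP ->; constructor.
have cl : c \in l' by rewrite -(perm_mem ll) mem_head.
case/splitPr: cl ll => l1 l2 ll; constructor; first exact: tree_iso_refl.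
by apply: IH; rewrite -(perm_cons c) (permPl ll) perm_catC/= perm_cons perm_catC.
Qed.

Lemma tree_iso_child x (l1 l2 : seq (tree L)) c c' : tree_iso c c' ->
  tree_iso (Node x (l1 ++ c :: l2)) (Node x (l1 ++ c' :: l2)).
Proof.
move=> cc; constructor; elim: l1 => [|y l1 IH] /=.
  exact: (@ForestIsoCons _ _ _ _ [::] _ cc (forest_iso_refl _)).
exact: (@ForestIsoCons _ _ _ _ [::] _ (tree_iso_refl y) IH).
Qed.

End TreeIso.

Definition childless (L : Type) (t : tree L) : bool := let: Node _ cs := t in nilp cs.

Definition dead_opposite (s : bool) (t : tree bool) : bool :=
  (root_label t == ~~ s) && childless t.

(* The presence of a deleted [dead_opposite] child is a random bit that stays
   hidden from the estimator: it makes the deletion of the path from the parent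
   through [v] to its grandchild rare enough not to reverse their correlation. *)
Definition cut_edge (s : bool) (v : tree bool) : bool :=
  let: Node x ws := v in
  [&& x == ~~ s, has (dead_opposite x) ws &
      if [seq w <- ws | ~~ dead_opposite x w] is [:: w]
      then root_label w == ~~ x else false].

Fixpoint adversary (d : nat) (t : tree bool) : tree bool :=
  match d with
  | (e.+1 as d').+2 =>
    let: Node s cs := t in
    Node s (pmap (fun v => let: Node x ws := v in
      if cut_edge s v then None
      else Some (Node x (pmap (fun w =>
        if dead_opposite x w then None else Some (adversary d' w)) ws))) cs)
  | _ => t
  end.

Fixpoint cut_tree_refl (t : tree bool) : cut_tree t t.
Proof.
by case: t => x cs; constructor; elim: cs => [|c cs IH]; constructor.
Qed.

Lemma cut_children_pmap s (g : tree bool -> option (tree bool)) cs :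
  (forall c, if g c is Some c' then cut_tree c c' else root_label c = ~~ s) ->
  cut_children s cs (pmap g cs).
Proof.
move=> gP; elim: cs => /= [|c cs IH]; first by constructor.
by have := gP c; case: (g c) => [c'|] /= h; constructor.
Qed.

Lemma adversary_cutting : cutting_adversary adversary.
Proof.
move=> d t; have [n] := ubnP d; elim: n d t => // n IH [|[|[|d]]] t dn;
  try exact: cut_tree_refl.
case: t => s cs; constructor; apply: cut_children_pmap => -[x ws].
case: ifPn => [/and3P[/eqP-> //]|_].
constructor; apply: cut_children_pmap => w.
case: ifPn => [/andP[/eqP-> //]|_]; apply: (IH d.+1 w).
by rewrite (leq_trans _ (ltnSE dn)).
Qed.

Lemma adversary_childless d t : childless t -> adversary d t = t.
Proof. by case: d => [|[|[|d]]]; case: t => x []. Qed.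

Definition observation d (t : tree bool) : tree (option bool) :=
  observe d (adversary d t).

Definition live_observation d (t : tree bool) : option (tree (option bool)) :=
  if childless t then None else Some (observation d t).

Definition observed_child d (s : bool) (v : tree bool) : option (tree (option bool)) :=
  let: Node x ws := v in
  if cut_edge s v then None
  else Some (Node None
    (pmap (fun w => if dead_opposite x w then None else Some (observation d w)) ws)).

Lemma map_pmap (S T U : Type) (f : T -> U) (g : S -> option T) l :
  map f (pmap g l) = pmap (fun x => omap f (g x)) l.
Proof. by elim: l => //= x l <-; case: (g x). Qed.

Lemma observation_block d s cs :
  observation d.+3 (Node s cs) = Node None (pmap (observed_child d.+1 s) cs).
Proof.
rewrite /observation [observe _ _]/= map_pmap; congr Node; apply: eq_pmap => -[x ws].
rewrite /observed_child; case: ifPn => // _.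
rewrite [omap _ _]/=; congr (Some (Node _ _)).
by rewrite map_pmap; apply: eq_pmap => w; case: ifP.
Qed.

Lemma size_pmap_live_observation d cs :
  size (pmap (live_observation d) cs) = count (fun c => ~~ childless c) cs.
Proof.
by rewrite size_pmap; apply: eq_count => c; rewrite /live_observation; case: childless.
Qed.

Lemma tree_iso_invariant_perm (T : Type) (F : tree (option bool) -> T) :
  (forall o o', tree_iso o o' -> F o = F o') ->
  forall l l', perm_eq l l' -> F (Node None l) = F (Node None l').
Proof. by move=> Fi l l' ll; apply: Fi; exact: tree_iso_perm. Qed.

Section OwnOppChildren.
Variables (x : bool) (own opp : seq (tree bool)).
Hypothesis ownP : all (fun c => root_label c == x) own.
Hypothesis oppP : all (fun c => root_label c == ~~ x) opp.

Let own_not_dead : {in own, forall w, dead_opposite x w = false}.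
Proof. by move=> w /(allP ownP)/eqP; rewrite /dead_opposite => ->; case: (x). Qed.

Let opp_dead : {in opp, forall w, dead_opposite x w = childless w}.
Proof. by move=> w /(allP oppP); rewrite /dead_opposite => ->. Qed.

Lemma filter_not_dead : [seq w <- own ++ opp | ~~ dead_opposite x w] =
  own ++ [seq w <- opp | ~~ childless w].
Proof.
rewrite filter_cat; congr (_ ++ _).
  by rewrite (eq_in_filter (a2 := predT)) ?filter_predT// => w /own_not_dead ->.
by apply: eq_in_filter => w /opp_dead ->.
Qed.

Lemma cut_edge_own_opp s : cut_edge s (Node x (own ++ opp)) =
  [&& x == ~~ s, has (@childless _) opp, nilp own &
      count (fun w => ~~ childless w) opp == 1%N].
Proof.
rewrite /cut_edge filter_not_dead has_cat (eq_in_has opp_dead).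
rewrite (_ : has _ own = false); last by apply/hasPn => w /own_not_dead ->.
congr [&& _, _ & _]; rewrite -size_filter.
case: own ownP => [_|w l /= /andP[/eqP wx _]]; last first.
  by case: (l ++ _) => //; rewrite wx; case: (x).
have : all (fun c => root_label c == ~~ x) [seq w <- opp | ~~ childless w].
  by apply/allP => w; rewrite mem_filter => /andP[_]; exact: (allP oppP).
by case: [seq w <- opp | _] => [|w [|w' l]] //= /andP[-> _].
Qed.

Lemma observed_child_own_opp d s : observed_child d s (Node x (own ++ opp)) =
  if cut_edge s (Node x (own ++ opp)) then None
  else Some (Node None (map (observation d) own ++ pmap (live_observation d) opp)).
Proof.
rewrite /observed_child; case: ifP => // _; congr (Some (Node _ _)).
rewrite pmap_cat; congr (_ ++ _).
  rewrite (eq_in_pmap (f2 := some \o observation d)); last first.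
    by move=> w /own_not_dead ->.
  by elim: (own) => //= w l ->.
by apply: eq_in_pmap => w /opp_dead ->.
Qed.

End OwnOppChildren.

(** * Law of the observation of a two-level block *)

Section NodeWeight.
Context {R : realType} {L : choiceType}.
Local Notation T := (tree (option L)).
Local Open Scope ereal_scope.

Definition node_weight (p : seq T -> R) (o : T) : R :=
  if o is Node None l then p l else 0%R.

Lemma node_weight_ge0 (p : seq T -> R) o :
  (forall l, 0 <= p l)%R -> (0 <= node_weight p o)%R.
Proof. by move=> p0; case: o => [[y|] l] /=. Qed.

Lemma wsum_node_weight (p : seq T -> R) (f : T -> \bar R) :
  (forall l, (0 <= p l)%R) -> (forall o, 0 <= f o) ->
  wsum (node_weight p) f = wsum p (f \o Node None).
Proof.
move=> p0 f0; have w0 := @node_weight_ge0 p ^~ p0.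
rewrite /wsum esum_tree; last by move=> o; rewrite mule_ge0 ?lee_fin.
rewrite (@esum_single _ _ None)//.
  by apply: esum_ge0 => l _; rewrite mule_ge0 ?lee_fin.
by case=> // y _; rewrite esum1// => l _; rewrite mul0e.
Qed.

End NodeWeight.

Section Block.
Context {R : realType}.
Variables a b : R.
Hypotheses (a0 : (0 < a)%R) (b0 : (0 < b)%R).
Local Notation T := (tree (option bool)).
Local Notation empty := (Node None [::] : T).
Implicit Type L : bool -> T -> R.

Local Open Scope ereal_scope.

Definition childless_prob : R := expR (- (a / 2 + b / 2)).

(* [L s] is the law of the observation on the event that the root, of spin [s],
   has a child in the precursor tree, up to isomorphism of observations. *)
Definition live_law d L : Prop := forall s (F : bool -> T -> \bar R),
  (forall c o, 0 <= F c o) ->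
  (forall c o o', tree_iso o o' -> F c o = F c o') ->
  wsum (broadcast_pmf a b d s) (fun t => F (childless t) (observation d t)) =
  wsum (L s) (F false) + childless_prob%:E * F true empty.

Definition dead_rate : R := (b / 2 * childless_prob)%R.
Definition no_dead_prob : R := expR (- dead_rate).

(* The intensities, on observations, of the children of a vertex of spin [x] that
   are not [dead_opposite]: those of spin [x], those of the opposite spin, all. *)
Definition own_grandchild L x : T -> R :=
  (a / 2 \*o (L x \+ childless_prob \*o (fun o => (o == empty)%:R)))%R.
Definition opp_grandchild L x : T -> R := (b / 2 \*o L (~~ x))%R.
Definition grandchild L x : T -> R := (own_grandchild L x \+ opp_grandchild L x)%R.

(* The law of the observations of the children of a vertex of spin [x], for
   [cut_law] on the event that they are not a single one of opposite spin. *)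
Definition uncut_law L x : seq T -> R := poisson_law (grandchild L x).

Definition cut_law L x (l : seq T) : R :=
  if l is [:: o] then (expR (- fine (mass (grandchild L x))) * own_grandchild L x o)%R
  else uncut_law L x l.

(* The laws of the observations below a child, of the same and of the opposite
   spin, of a vertex of spin [s], on the event that this child is not cut off. *)
Definition own_forest_law L s : seq T -> R := uncut_law L s.
Definition opp_forest_law L s : seq T -> R :=
  (no_dead_prob \*o uncut_law L (~~ s) \+ (1 - no_dead_prob) \*o cut_law L (~~ s))%R.

Definition forest_intensity L s : seq T -> R :=
  (a / 2 \*o own_forest_law L s \+ b / 2 \*o opp_forest_law L s)%R.

Definition child_intensity L s : T -> R := node_weight (forest_intensity L s).

Definition next_law L s : T -> R := node_weight
  (fun l => poisson_law (child_intensity L s) l - (nilp l)%:R * childless_prob)%R.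

Let a20 : (0 <= a / 2)%R. Proof. by rewrite divr_ge0// ltW. Qed.
Let b20 : (0 <= b / 2)%R. Proof. by rewrite divr_ge0// ltW. Qed.

Lemma childless_prob_ge0 : (0 <= childless_prob)%R. Proof. exact: expR_ge0. Qed.

Lemma childless_prob_le1 : (childless_prob <= 1)%R.
Proof. by rewrite expR_le1 oppr_le0 addr_ge0. Qed.

Lemma dead_rate_ge0 : (0 <= dead_rate)%R.
Proof. by rewrite mulr_ge0 ?childless_prob_ge0. Qed.

Lemma no_dead_prob_ge0 : (0 <= no_dead_prob)%R. Proof. exact: expR_ge0. Qed.

Lemma no_dead_prob_compl_ge0 : (0 <= 1 - no_dead_prob)%R.
Proof. by rewrite subr_ge0 expR_le1 oppr_le0 dead_rate_ge0. Qed.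

#[local] Hint Resolve childless_prob_ge0 dead_rate_ge0 no_dead_prob_ge0
  no_dead_prob_compl_ge0 : core.

Section Nonnegativity.
Variable L : bool -> T -> R.
Hypothesis L0 : forall s o, (0 <= L s o)%R.

Lemma own_grandchild_ge0 x o : (0 <= own_grandchild L x o)%R.
Proof. by rewrite mulr_ge0//= addr_ge0 ?mulr_ge0. Qed.

Lemma opp_grandchild_ge0 x o : (0 <= opp_grandchild L x o)%R.
Proof. by rewrite mulr_ge0. Qed.

Lemma grandchild_ge0 x o : (0 <= grandchild L x o)%R.
Proof. by rewrite addr_ge0 ?own_grandchild_ge0 ?opp_grandchild_ge0. Qed.

Lemma uncut_law_ge0 x l : (0 <= uncut_law L x l)%R.
Proof. by rewrite poisson_law_ge0// => o; exact: grandchild_ge0. Qed.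

Lemma cut_law_ge0 x l : (0 <= cut_law L x l)%R.
Proof.
rewrite /cut_law; case: l => [|o [|o' l]]; try exact: uncut_law_ge0.
by rewrite mulr_ge0 ?own_grandchild_ge0.
Qed.

Lemma opp_forest_law_ge0 s l : (0 <= opp_forest_law L s l)%R.
Proof. by rewrite addr_ge0// mulr_ge0 ?uncut_law_ge0 ?cut_law_ge0. Qed.

Lemma forest_intensity_ge0 s l : (0 <= forest_intensity L s l)%R.
Proof. by rewrite addr_ge0// mulr_ge0 ?uncut_law_ge0 ?opp_forest_law_ge0. Qed.

Lemma child_intensity_ge0 s o : (0 <= child_intensity L s o)%R.
Proof. by apply: node_weight_ge0 => l; exact: forest_intensity_ge0. Qed.

End Nonnegativity.

#[local] Hint Extern 0 (is_true (@Order.le _ _ _ (own_grandchild _ _ _))) =>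
  solve [exact: own_grandchild_ge0] : core.
#[local] Hint Extern 0 (is_true (@Order.le _ _ _ (opp_grandchild _ _ _))) =>
  solve [exact: opp_grandchild_ge0] : core.
#[local] Hint Extern 0 (is_true (@Order.le _ _ _ (grandchild _ _ _))) =>
  solve [exact: grandchild_ge0] : core.
#[local] Hint Extern 0 (is_true (@Order.le _ _ _ (uncut_law _ _ _))) =>
  solve [exact: uncut_law_ge0] : core.
#[local] Hint Extern 0 (is_true (@Order.le _ _ _ (cut_law _ _ _))) =>
  solve [exact: cut_law_ge0] : core.
#[local] Hint Extern 0 (is_true (@Order.le _ _ _ (own_forest_law _ _ _))) =>
  solve [exact: uncut_law_ge0] : core.
#[local] Hint Extern 0 (is_true (@Order.le _ _ _ (opp_forest_law _ _ _))) =>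
  solve [exact: opp_forest_law_ge0] : core.
#[local] Hint Extern 0 (is_true (@Order.le _ _ _ (forest_intensity _ _ _))) =>
  solve [exact: forest_intensity_ge0] : core.
#[local] Hint Extern 0 (is_true (@Order.le _ _ _ (child_intensity _ _ _))) =>
  solve [exact: child_intensity_ge0] : core.

Section NextLaw.
Variables (d : nat) (L : bool -> T -> R).
Hypothesis L0 : forall s o, (0 <= L s o)%R.
Hypothesis LP : live_law d.+1 L.

Lemma mass_live_law s : mass (L s) = (1 - childless_prob)%:E.
Proof.
apply: adde_EFin_inj; rewrite -[RHS](mass_broadcast a0 b0 d.+1 s) addeC.
by rewrite [mass (broadcast_pmf _ _ _ _)](LP s (F := fun _ _ => 1))// mule1.
Qed.

Lemma wsum_own_grandchild x (f : T -> \bar R) : (forall o, 0 <= f o) ->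
  wsum (own_grandchild L x) f =
  (a / 2)%:E * (wsum (L x) f + childless_prob%:E * f empty).
Proof.
move=> f0; have delta0 (o : T) : (0 <= childless_prob * (o == empty)%:R :> R)%R by [].
by rewrite wsumZl ?wsumDl ?wsumZl ?wsum_delta.
Qed.

Lemma mass_own_grandchild x : mass (own_grandchild L x) = (a / 2)%:E.
Proof.
by rewrite [mass _]wsum_own_grandchild// [wsum _ _]mass_live_law mule1 -EFinD subrK
  mule1.
Qed.

Lemma mass_opp_grandchild x :
  mass (opp_grandchild L x) = (b / 2 * (1 - childless_prob))%:E.
Proof. by rewrite massZ// mass_live_law. Qed.

Definition grandchild_rate : R := (a / 2 + b / 2 - dead_rate)%R.

Lemma mass_grandchild x : mass (grandchild L x) = grandchild_rate%:E.
Proof.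
rewrite massD// mass_own_grandchild mass_opp_grandchild -EFinD.
by rewrite /grandchild_rate /dead_rate mulrBr mulr1 addrA.
Qed.

Lemma wsum_own_intensity x (f : T -> \bar R) : (forall o, 0 <= f o) ->
  (forall o o', tree_iso o o' -> f o = f o') ->
  wsum (own_intensity a b d.+1 x) (f \o observation d.+1) = wsum (own_grandchild L x) f.
Proof.
move=> f0 fi; rewrite wsumZl//.
by rewrite wsum_own_grandchild// -(LP x (F := fun=> f)).
Qed.

Lemma wsum_opp_intensity_live x (f : T -> \bar R) : (forall o, 0 <= f o) ->
  (forall o o', tree_iso o o' -> f o = f o') ->
  wsum (opp_intensity a b d.+1 x)
    (fun w => if live_observation d.+1 w is Some o then f o else 0) =
  wsum (opp_grandchild L x) f.
Proof.
move=> f0 fi; rewrite wsumZl ?wsumZl//; last by move=> w; case: live_observation.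
rewrite (eq_wsum _ (G := fun w =>
  (fun c o => if c then 0 else f o) (childless w) (observation d.+1 w))).
  rewrite (LP (~~ x) (F := fun c o => if c then 0 else f o)) ?mule0 ?adde0//.
  by case=> // o o' oo; exact: fi.
by move=> w; rewrite /live_observation; case: childless.
Qed.

Lemma wsum_opp_intensity_dead x : wsum (opp_intensity a b d.+1 x)
  (fun w => if live_observation d.+1 w is Some _ then 0 else 1) = dead_rate%:E.
Proof.
rewrite wsumZl//; last by move=> w; case: live_observation.
rewrite (eq_wsum _ (G := fun w =>
  (fun c (o : T) => if c then 1 else 0) (childless w) (observation d.+1 w))).
  rewrite (LP (~~ x) (F := fun c o => if c then 1 else 0))//.
  by rewrite wsum0 add0e mule1.
by move=> w; rewrite /live_observation; case: childless.
Qed.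

Lemma wsum_grandchildren x (G : bool -> seq T -> seq T -> \bar R) :
  (forall j k1 k2, 0 <= G j k1 k2) ->
  (forall j l1 o o' l2 k, tree_iso o o' ->
     G j (l1 ++ o :: l2) k = G j (l1 ++ o' :: l2) k) ->
  (forall j k l1 o o' l2, tree_iso o o' ->
     G j k (l1 ++ o :: l2) = G j k (l1 ++ o' :: l2)) ->
  wsum (poisson_law (own_intensity a b d.+1 x)) (fun l1 =>
    wsum (poisson_law (opp_intensity a b d.+1 x)) (fun l2 =>
      G (has (@childless _) l2) (map (observation d.+1) l1)
        (pmap (live_observation d.+1) l2))) =
  no_dead_prob%:E * wsum (poisson_law (own_grandchild L x))
    (fun k1 => wsum (poisson_law (opp_grandchild L x)) (G false k1)) +
  (1 - no_dead_prob)%:E * wsum (poisson_law (own_grandchild L x))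
    (fun k1 => wsum (poisson_law (opp_grandchild L x)) (G true k1)).
Proof.
move=> G0 Gown Gopp.
pose H k1 := no_dead_prob%:E * wsum (poisson_law (opp_grandchild L x)) (G false k1) +
  (1 - no_dead_prob)%:E * wsum (poisson_law (opp_grandchild L x)) (G true k1).
have H0 k1 : 0 <= H k1 by rewrite /H.
transitivity (wsum (poisson_law (own_intensity a b d.+1 x))
    (H \o map (observation d.+1))).
  apply: eq_wsum => l1; rewrite /H /=.
  rewrite -(wsum_poisson_thin _ _ (mass_opp_grandchild x) (@wsum_opp_intensity_live x)
    (wsum_opp_intensity_dead x)
    (G := fun j => G j (map (observation d.+1) l1)))//; last first.
    by move=> j *; exact: Gopp.
  by apply: eq_wsum => l2; congr G; apply: eq_has => w; rewrite /live_observation;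
    case: childless.
rewrite (wsum_poisson_map _ _ (@wsum_own_intensity x))//; last first.
  by move=> l1 o o' l2 oo; rewrite /H; congr (_ * _ + _ * _); apply: eq_wsum => k;
    exact: Gown.
by rewrite wsumDr ?wsumZr.
Qed.

Lemma wsum_uncut_law x (g : seq T -> \bar R) : (forall l, 0 <= g l) ->
  (forall l l', perm_eq l l' -> g l = g l') ->
  wsum (poisson_law (own_grandchild L x)) (fun k1 =>
    wsum (poisson_law (opp_grandchild L x)) (fun k2 => g (k1 ++ k2))) =
  wsum (uncut_law L x) g.
Proof.
move=> g0 gp.
by rewrite (wsum_poisson_superpose _ _ (mass_own_grandchild x) (mass_opp_grandchild x)).
Qed.

Lemma wsum_cut_lawE x (g : seq T -> \bar R) : (forall l, 0 <= g l) ->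
  wsum (cut_law L x) g =
  wsum (uncut_law L x) (fun l => if size l == 1%N then 0 else g l) +
  (expR (- grandchild_rate))%:E * wsum (own_grandchild L x) (fun o => g [:: o]).
Proof.
move=> g0; rewrite wsum_size1//; congr (_ + _).
  by apply: eq_esum => -[|o [|o' l]] _; rewrite //= !mule0.
by rewrite -wsumZl//; apply: eq_esum => o _; rewrite /cut_law mass_grandchild.
Qed.

Lemma wsum_cut_law x (g : seq T -> \bar R) : (forall l, 0 <= g l) ->
  (forall l l', perm_eq l l' -> g l = g l') ->
  wsum (poisson_law (own_grandchild L x)) (fun k1 =>
    wsum (poisson_law (opp_grandchild L x)) (fun k2 =>
      if nilp k1 && (size k2 == 1%N) then 0 else g (k1 ++ k2))) =
  wsum (cut_law L x) g.
Proof.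
move=> g0 gp; rewrite wsum_cut_lawE//.
pose other l := if size l == 1%N then 0 else g l.
have other0 l : 0 <= other l by rewrite /other.
have other_perm l l' : perm_eq l l' -> other l = other l'.
  by move=> ll; rewrite /other (perm_size ll) (gp _ _ ll).
rewrite -(wsum_uncut_law x other0 other_perm).
pose single k1 := if size k1 == 1%N then g k1 else 0.
have single0 l : 0 <= single l by rewrite /single.
have other_single k1 k2 : (if nilp k1 && (size k2 == 1%N) then 0 else g (k1 ++ k2)) =
    other (k1 ++ k2) + (if nilp k2 then single k1 else 0).
  rewrite /other /single size_cat.
  by case: k1 k2 => [|o [|o' k1]] [|p [|p' k2]] //=;
    rewrite ?addnS ?cats0 ?adde0 ?add0e.
have no_opp k1 : wsum (poisson_law (opp_grandchild L x))
    (fun k2 => if nilp k2 then single k1 else 0) =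
    (expR (- (b / 2 * (1 - childless_prob))))%:E * single k1.
  by rewrite (wsum_poisson_nilp _ (mass_opp_grandchild x))// mule0 adde0.
under eq_wsum => k1.
  under eq_wsum do rewrite other_single.
  rewrite wsumDr// no_opp; over.
rewrite wsumDr//; congr (_ + _).
rewrite wsumZr// (wsum_poisson_size1 _ (mass_own_grandchild x))//.
rewrite [X in X + _](_ : _ = 0) ?add0e ?muleA -?EFinM -?expRD; last first.
  rewrite -[RHS](wsum0 (poisson_law (own_grandchild L x))); apply: eq_wsum => l.
  by rewrite /single; case: (size l == 1%N).
rewrite /single/=; congr ((expR _)%:E * _).
by rewrite /grandchild_rate /dead_rate; ring.
Qed.

Lemma wsum_observed_child s x (f : T -> \bar R) : (forall o, 0 <= f o) ->
  (forall o o', tree_iso o o' -> f o = f o') ->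
  wsum (broadcast_pmf a b d.+2 x)
    (fun v => if observed_child d.+1 s v is Some o then f o else 0) =
  no_dead_prob%:E * wsum (uncut_law L x) (f \o Node None) +
  (1 - no_dead_prob)%:E *
    wsum (if x == s then uncut_law L x else cut_law L x) (f \o Node None).
Proof.
move=> f0 fi; pose g := f \o Node None.
have g0 l : 0 <= g l by exact: f0.
have gp : forall l l', perm_eq l l' -> g l = g l' := tree_iso_invariant_perm fi.
pose G j k1 k2 := if [&& x == ~~ s, j, nilp k1 & size k2 == 1%N] then 0
                  else g (k1 ++ k2).
have G0 j k1 k2 : 0 <= G j k1 k2 by rewrite /G.
rewrite wsum_broadcast//; last by move=> v; case: observed_child.
transitivity (wsum (poisson_law (own_intensity a b d.+1 x)) (fun l1 =>
    wsum (poisson_law (opp_intensity a b d.+1 x)) (fun l2 =>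
      G (has (@childless _) l2) (map (observation d.+1) l1)
        (pmap (live_observation d.+1) l2)))).
  apply: eq_wsum_support => l1 /poisson_law_support own.
  apply: eq_wsum_support => l2 /poisson_law_support opp.
  have ownP : all (fun c => root_label c == x) l1.
    by apply: sub_all own => c /own_intensity_root ->.
  have oppP : all (fun c => root_label c == ~~ x) l2.
    by apply: sub_all opp => c /opp_intensity_root ->.
  rewrite observed_child_own_opp// cut_edge_own_opp//.
  by rewrite /G /g /nilp size_map size_pmap_live_observation; case: ifP.
rewrite wsum_grandchildren//; last 2 first.
- move=> j l1 o o' l2 k oo; rewrite /G /nilp !size_cat/=.
  by case: ifP => // _; rewrite /g/= -!catA; exact/fi/tree_iso_child.
- move=> j k l1 o o' l2 oo; rewrite /G !size_cat/=.
  by case: ifP => // _; rewrite /g/= !catA; exact/fi/tree_iso_child.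
congr (_ * _ + _ * _).
  rewrite -(wsum_uncut_law x g0 gp); apply: eq_wsum => k1; apply: eq_wsum => k2.
  by rewrite /G andbF.
case: eqVneq => [xs|xs].
  rewrite -(wsum_uncut_law x g0 gp); apply: eq_wsum => k1; apply: eq_wsum => k2.
  by rewrite /G xs; case: (s).
rewrite -(wsum_cut_law x g0 gp); apply: eq_wsum => k1; apply: eq_wsum => k2.
by rewrite /G; case: (x) (s) xs => -[].
Qed.

Lemma wsum_own_forest_law s (f : T -> \bar R) : (forall o, 0 <= f o) ->
  (forall o o', tree_iso o o' -> f o = f o') ->
  wsum (broadcast_pmf a b d.+2 s)
    (fun v => if observed_child d.+1 s v is Some o then f o else 0) =
  wsum (own_forest_law L s) (f \o Node None).
Proof.
move=> f0 fi; rewrite wsum_observed_child// eqxx -ge0_muleDl//.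
by rewrite -EFinD addrC subrK mul1e.
Qed.

Lemma wsum_opp_forest_law s (f : T -> \bar R) : (forall o, 0 <= f o) ->
  (forall o o', tree_iso o o' -> f o = f o') ->
  wsum (broadcast_pmf a b d.+2 (~~ s))
    (fun v => if observed_child d.+1 s v is Some o then f o else 0) =
  wsum (opp_forest_law L s) (f \o Node None).
Proof.
move=> f0 fi; rewrite wsum_observed_child//.
rewrite (_ : (~~ s == s) = false); last by case: (s).
by rewrite -!wsumZl// -wsumDl.
Qed.

Definition cut_rate : R := (b / 2 * ((1 - no_dead_prob) *
  (expR (- grandchild_rate) * (b / 2 * (1 - childless_prob)))))%R.

Definition child_rate : R := (a / 2 + b / 2 - cut_rate)%R.

Lemma mass_uncut_law x : mass (uncut_law L x) = 1.
Proof. exact: mass_poisson_law (mass_grandchild x). Qed.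

Lemma mass_cut_law x : mass (cut_law L x) =
  (1 - expR (- grandchild_rate) * (b / 2 * (1 - childless_prob)))%:E.
Proof.
apply: adde_EFin_inj; rewrite -[RHS](mass_uncut_law x) addeC.
rewrite [mass (cut_law _ _)]wsum_cut_lawE// EFinM -(mass_opp_grandchild x).
rewrite [RHS](wsum_poisson_size1 _ (mass_grandchild x))//.
by rewrite [wsum (grandchild L x) _]wsumDl// ge0_muleDr// addeA.
Qed.

Lemma mass_opp_forest_law s : mass (opp_forest_law L s) =
  (1 - (1 - no_dead_prob) *
    (expR (- grandchild_rate) * (b / 2 * (1 - childless_prob))))%:E.
Proof.
rewrite massD// (massZ (uncut_law_ge0 L0 _))// (massZ (cut_law_ge0 L0 _))//.
rewrite mass_uncut_law mass_cut_law mule1 -EFinM -EFinD; congr EFin.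
by rewrite mulrBr mulr1 addrA [(no_dead_prob + _)%R]addrC subrK.
Qed.

Lemma wsum_child_intensity s (f : T -> \bar R) : (forall o, 0 <= f o) ->
  wsum (child_intensity L s) f =
  (a / 2)%:E * wsum (own_forest_law L s) (f \o Node None) +
  (b / 2)%:E * wsum (opp_forest_law L s) (f \o Node None).
Proof. by move=> f0; rewrite wsum_node_weight// -!wsumZl// -wsumDl. Qed.

Lemma mass_child_intensity s : mass (child_intensity L s) = child_rate%:E.
Proof.
rewrite [mass _]wsum_child_intensity//.
rewrite [wsum (own_forest_law _ _) _]mass_uncut_law mule1.
rewrite [wsum (opp_forest_law _ _) _]mass_opp_forest_law -EFinM -EFinD.
by rewrite /child_rate /cut_rate mulrBr mulr1 addrA.
Qed.

Lemma wsum_child_kept s (f : T -> \bar R) : (forall o, 0 <= f o) ->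
  (forall o o', tree_iso o o' -> f o = f o') ->
  wsum (own_intensity a b d.+2 s \+ opp_intensity a b d.+2 s)%R
    (fun v => if observed_child d.+1 s v is Some o then f o else 0) =
  wsum (child_intensity L s) f.
Proof.
move=> f0 fi; have h0 v : 0 <= (if observed_child d.+1 s v is Some o then f o else 0).
  by case: observed_child.
rewrite wsumDl// !wsumZl// wsum_own_forest_law// wsum_opp_forest_law//.
by rewrite wsum_child_intensity.
Qed.

Lemma wsum_child_deleted s :
  wsum (own_intensity a b d.+2 s \+ opp_intensity a b d.+2 s)%R
    (fun v => if observed_child d.+1 s v is Some _ then 0 else 1) = cut_rate%:E.
Proof.
have -> : cut_rate = (a / 2 + b / 2 - child_rate)%R by rewrite /child_rate; ring.
apply: adde_EFin_inj; rewrite -(mass_child_intensity s).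
rewrite -[mass (child_intensity _ _)]wsum_child_kept//.
rewrite -wsumDr//; [|by move=> v; case: observed_child..].
rewrite EFinD -(mass_own_intensity a0 b0 d.+2 s) -(mass_opp_intensity a0 b0 d.+2 s).
rewrite -massD//.
by apply: eq_wsum => v; case: observed_child; rewrite ?adde0 ?add0e.
Qed.

Lemma cut_rate_ge0 : (0 <= cut_rate)%R.
Proof.
rewrite -lee_fin -(wsum_child_deleted true); apply: wsum_ge0 => // v.
by case: observed_child.
Qed.

Lemma childless_prob_le : (childless_prob <= expR (- child_rate))%R.
Proof. by rewrite ler_expR lerN2 gerBl cut_rate_ge0. Qed.

Lemma next_forest_law_ge0 s l :
  (0 <= poisson_law (child_intensity L s) l - (nilp l)%:R * childless_prob)%R.
Proof.
case: l => [|o l]; last by rewrite mul0r subr0 poisson_law_ge0.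
by rewrite mul1r poisson_law_nil mass_child_intensity subr_ge0 childless_prob_le.
Qed.

Lemma next_law_ge0 s o : (0 <= next_law L s o)%R.
Proof. by apply: node_weight_ge0; exact: next_forest_law_ge0. Qed.

Lemma wsum_next_law s (f : T -> \bar R) : (forall o, 0 <= f o) ->
  wsum (next_law L s) f = (expR (- child_rate) - childless_prob)%:E * f empty +
    wsum (poisson_law (child_intensity L s))
      (fun l => if nilp l then 0 else f (Node None l)).
Proof.
move=> f0; rewrite wsum_node_weight//; last exact: next_forest_law_ge0.
rewrite wsum_nil//; last exact: next_forest_law_ge0.
rewrite poisson_law_nil mass_child_intensity mul1r; congr (_ + _).
by apply: eq_esum => -[|o l] _ /=; rewrite ?mule0// mul0r subr0.
Qed.

Lemma live_law_step : live_law d.+3 (next_law L).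
Proof.
move=> s F F0 Fi.
pose G (j : bool) l := F (~~ j && nilp l) (Node None l).
have G0 j l : 0 <= G j l by exact: F0.
have GE l : F (childless (Node s l)) (observation d.+3 (Node s l)) =
    G (has (fun v => ~~ observed_child d.+1 s v) l) (pmap (observed_child d.+1 s) l).
  rewrite observation_block /G; congr F => /=.
  by case: l => //= v l; case: observed_child => //= o; rewrite andbF.
have Gp j l l' : perm_eq l l' -> G j l = G j l'.
  move=> ll; rewrite /G /nilp (perm_size ll).
  by apply: tree_iso_invariant_perm => //; exact: Fi.
rewrite wsum_broadcast_sym//; last first.
  move=> l l' ll; rewrite !GE (perm_has _ ll).
  by rewrite (Gp _ _ (pmap (observed_child d.+1 s) l'))//; exact: perm_pmap.
rewrite (eq_wsum _ GE) (wsum_poisson_thin _ _ (mass_child_intensity s)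
  (@wsum_child_kept s) (wsum_child_deleted s))//; last first.
  by move=> j l1 o o' l2 oo; rewrite /G /nilp !size_cat/=; exact/Fi/tree_iso_child.
rewrite wsum_next_law// [wsum _ (G false)]wsum_nil// [wsum _ (G true)]wsum_nil//.
rewrite poisson_law_nil mass_child_intensity.
set S := wsum _ (fun l => if nilp l then 0 else F false _).
have -> j : wsum (poisson_law (child_intensity L s))
    (fun l => if nilp l then 0 else G j l) = S.
  by apply: eq_wsum => l; rewrite /G; case: nilp; rewrite ?andbF.
have S0 : 0 <= S by exact: wsum_ge0.
rewrite /G /nilp/=; set r := expR (- cut_rate); set p := expR (- child_rate).
have p0 : (0 <= p)%R := expR_ge0 _; have r0 : (0 <= r)%R := expR_ge0 _.
have r1 : (0 <= 1 - r)%R by rewrite subr_ge0 expR_le1 oppr_le0 cut_rate_ge0.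
have -> : childless_prob = (r * p)%R.
  by rewrite -expRD /childless_prob /child_rate; congr expR; ring.
rewrite !ge0_muleDr// !muleA -!EFinM addeACA -ge0_muleDl//.
rewrite -EFinD [(r + _)%R]addrC subrK mul1e mulrBl mul1r.
by rewrite [RHS]addeAC; congr (_ + _); rewrite addeC.
Qed.

End NextLaw.
End Block.

(** * Hellinger distance *)

Section SqrtDist.
Context {R : realType}.
Implicit Types x y A B c : R.

Definition sqrt_dist2 x y : R := (Num.sqrt x - Num.sqrt y) ^+ 2.

Lemma sqrt_dist2_ge0 x y : 0 <= sqrt_dist2 x y. Proof. exact: sqr_ge0. Qed.

Lemma sqrt_dist2xx x : sqrt_dist2 x x = 0.
Proof. by rewrite /sqrt_dist2 subrr expr0n. Qed.

Lemma sqrt_dist2M c x y : 0 <= c -> sqrt_dist2 (c * x) (c * y) = c * sqrt_dist2 x y.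
Proof. by move=> c0; rewrite /sqrt_dist2 !sqrtrM// -mulrBr exprMn sqr_sqrtr. Qed.

Lemma sqrt_dist2_affinity x y : 0 <= x -> 0 <= y ->
  sqrt_dist2 x y + 2 * Num.sqrt (x * y) = x + y.
Proof.
move=> x0 y0; rewrite /sqrt_dist2 sqrtrM//.
rewrite -[in RHS](sqr_sqrtr x0) -[in RHS](sqr_sqrtr y0); ring.
Qed.

(* AM-GM: [n (p + q) <= c n^2 / 2 + (p + q)^2 / (2 c)] with [n = |p - q|]. *)
Lemma dist_sqr_le (p q c : R) : 0 <= p -> 0 <= q -> 0 < c ->
  `|p ^+ 2 - q ^+ 2| <= c / 2 * (p - q) ^+ 2 + c^-1 * (p ^+ 2 + q ^+ 2).
Proof.
move=> p0 q0 c0.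
rewrite subr_sqr normrM (ger0_norm (addr_ge0 p0 q0)).
rewrite -[in leRHS](@real_normK _ (p - q)) ?num_real//.
set n := `|p - q|.
have : 0 <= c / 2 * (n - c^-1 * (p + q)) ^+ 2 + c^-1 / 2 * (p - q) ^+ 2.
  by rewrite addr_ge0// mulr_ge0 ?sqr_ge0// divr_ge0// ?invr_ge0 ltW.
have -> : c / 2 * (n - c^-1 * (p + q)) ^+ 2 + c^-1 / 2 * (p - q) ^+ 2 =
    c / 2 * n ^+ 2 + c^-1 * (p ^+ 2 + q ^+ 2) - n * (p + q).
  by field; rewrite gt_eqF.
by rewrite subr_ge0.
Qed.

Lemma dist_sqrt_dist2 x y c : 0 <= x -> 0 <= y -> 0 < c ->
  `|x - y| <= c / 2 * sqrt_dist2 x y + c^-1 * (x + y).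
Proof.
move=> x0 y0 c0; have := dist_sqr_le (sqrtr_ge0 x) (sqrtr_ge0 y) c0.
by rewrite !sqr_sqrtr.
Qed.

Definition contraction A B : R := (A - B) ^+ 2 / (A + B).

Lemma contraction_ge0 A B : 0 <= A -> 0 <= B -> 0 <= contraction A B.
Proof. by move=> A0 B0; rewrite divr_ge0 ?sqr_ge0. Qed.

Section Mixture.
Variables A B c x y : R.
Hypotheses (A0 : 0 <= A) (B0 : 0 <= B) (c0 : 0 <= c) (x0 : 0 <= x) (y0 : 0 <= y).

Let X := A * x + B * y + c.
Let Y := B * x + A * y + c.

Let X0 : 0 <= X. Proof. by rewrite /X. Qed.
Let Y0 : 0 <= Y. Proof. by rewrite /Y. Qed.

Lemma sqrt_mixM_ge : (A + B) * (Num.sqrt x * Num.sqrt y) <= Num.sqrt X * Num.sqrt Y.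
Proof.
rewrite -ler_sqr ?nnegrE ?mulr_ge0 ?sqrtr_ge0 ?addr_ge0//.
rewrite !exprMn !sqr_sqrtr//.
have -> : X * Y = (A + B) ^+ 2 * (x * y) + (A * B * (x - y) ^+ 2 +
  c * ((A + B) * x + (A + B) * y + c)) by rewrite /X /Y; ring.
by rewrite lerDl addr_ge0// mulr_ge0 ?sqr_ge0.
Qed.

Lemma sqrt_mixD_ge :
  (A + B) * (Num.sqrt x + Num.sqrt y) ^+ 2 <= (Num.sqrt X + Num.sqrt Y) ^+ 2.
Proof.
rewrite !sqrrD !sqr_sqrtr// -subr_ge0; set u := Num.sqrt x * _; set v := Num.sqrt X * _.
rewrite (_ : _ - _ = 2 * c + 2 * (v - (A + B) * u)); last by rewrite /X /Y; ring.
by rewrite addr_ge0 ?mulr_ge0 ?subr_ge0 ?sqrt_mixM_ge.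
Qed.

Lemma sqrt_dist2_mix : 0 < A + B -> sqrt_dist2 X Y <= contraction A B * sqrt_dist2 x y.
Proof.
move=> AB0; have [xy0|xy0] := eqVneq (x + y) 0.
  have /andP[/eqP xE /eqP yE] : (x == 0) && (y == 0) by rewrite -paddr_eq0 ?xy0.
  by rewrite /X /Y xE yE !mulr0 !add0r !sqrt_dist2xx mulr0.
have xy_gt0 : 0 < (Num.sqrt x + Num.sqrt y) ^+ 2.
  rewrite sqrrD !sqr_sqrtr// addrAC ltr_wpDr ?mulrn_wge0 ?mulr_ge0 ?sqrtr_ge0//.
  by rewrite lt_def xy0 addr_ge0.
rewrite /contraction mulrAC ler_pdivlMr// -(ler_pM2r xy_gt0) -mulrA.
apply: le_trans (ler_wpM2l (sqrt_dist2_ge0 X Y) sqrt_mixD_ge) _.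
rewrite /sqrt_dist2 -exprMn -subr_sqr !sqr_sqrtr//.
rewrite -mulrA -exprMn -subr_sqr !sqr_sqrtr// -exprMn.
by rewrite (_ : X - Y = (A - B) * (x - y))//; rewrite /X /Y; ring.
Qed.

End Mixture.
End SqrtDist.

Section Hellinger.
Context {R : realType}.
Local Open Scope ereal_scope.

Definition hellinger2 (T : choiceType) (D : set T) (f g : T -> R) : \bar R :=
  \esum_(x in D) (sqrt_dist2 (f x) (g x))%:E.

Definition affinity (T : Type) (f g : T -> R) (x : T) : R := Num.sqrt (f x * g x)%R.

Lemma affinity_ge0 (T : Type) (f g : T -> R) x : (0 <= affinity f g x)%R.
Proof. exact: sqrtr_ge0. Qed.

Section hellinger2_theory.
Variables (T : choiceType) (f g : T -> R).

Lemma hellinger2_ge0 D : 0 <= hellinger2 D f g.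
Proof. by apply: esum_ge0 => x _; rewrite lee_fin sqrt_dist2_ge0. Qed.

Lemma hellinger2Z (c : R) : (0 <= c)%R ->
  hellinger2 setT (c \*o f)%R (c \*o g)%R = c%:E * hellinger2 setT f g.
Proof.
move=> c0; rewrite /hellinger2 -esumZl//; last first.
  by move=> x; rewrite lee_fin sqrt_dist2_ge0.
by apply: eq_esum => x _; rewrite /= sqrt_dist2M.
Qed.

Hypotheses (f0 : forall x, (0 <= f x)%R) (g0 : forall x, (0 <= g x)%R).

Lemma hellinger2_affinity :
  hellinger2 setT f g + 2%:E * mass (affinity f g) = mass f + mass g.
Proof.
rewrite /mass -wsumZl//; last exact: affinity_ge0.
rewrite -wsumDl// /hellinger2 /wsum -esumD//; last 2 first.
- by move=> x _; rewrite lee_fin sqrt_dist2_ge0.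
- by move=> x _; rewrite mule1 lee_fin mulr_ge0 ?affinity_ge0.
by apply: eq_esum => x _; rewrite !mule1 -EFinD sqrt_dist2_affinity.
Qed.

Lemma hellinger2_le_mass : hellinger2 setT f g <= mass f + mass g.
Proof.
by rewrite -hellinger2_affinity leeDl// mule_ge0// wsum_ge0//; exact: affinity_ge0.
Qed.

Lemma hellinger2_fin (m : R) : mass f = m%:E -> mass g = m%:E ->
  exists2 h : R, hellinger2 setT f g = h%:E & mass (affinity f g) = (m - h / 2)%:E.
Proof.
move=> fm gm; have := hellinger2_ge0 setT; have := hellinger2_le_mass.
rewrite fm gm; case hE : hellinger2 => [h| |] //= _ _; exists h => //.
have := hellinger2_affinity; rewrite hE fm gm -EFinD => /adde_EFin_inj aff.
rewrite -[LHS]mul1e (_ : 1 = (2^-1)%:E * 2%:E); last by rewrite -EFinM mulVf.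
by rewrite -muleA aff -EFinM; congr EFin; field.
Qed.

Lemma hellinger2_mix D (F G h : T -> R) (A B : R) :
  (0 <= A)%R -> (0 <= B)%R -> (0 < A + B)%R -> (forall x, (0 <= h x)%R) ->
  (forall x, D x -> F x = A * f x + B * g x + h x)%R ->
  (forall x, D x -> G x = B * f x + A * g x + h x)%R ->
  hellinger2 D F G <= (contraction A B)%:E * hellinger2 D f g.
Proof.
move=> A0 B0 AB0 h0 FE GE; rewrite /hellinger2 -esumZl//.
- by apply: le_esum => x Dx; rewrite -EFinM lee_fin FE// GE// sqrt_dist2_mix.
- by rewrite lee_fin contraction_ge0.
- by move=> x; rewrite lee_fin sqrt_dist2_ge0.
Qed.

Lemma wsum_test_le (P : pred T) (m c : R) : (0 < c)%R ->
  mass f = m%:E -> mass g = m%:E ->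
  wsum f (fun x => if P x then 1 else 0) + wsum g (fun x => if P x then 0 else 1) <=
  (m + c^-1 * m)%:E + (c / 4)%:E * hellinger2 setT f g.
Proof.
move=> c0 fm gm; have i0 : (0 <= c^-1)%R by rewrite invr_ge0 ltW.
have d0 x : (0 <= sqrt_dist2 (f x) (g x))%R by exact: sqrt_dist2_ge0.
have -> : (m + c^-1 * m)%:E =
    wsum ((2^-1 + c^-1 / 2) \*o (f \+ g))%R (fun=> 1).
  rewrite [wsum _ _]massZ// massD// fm gm -EFinD -EFinM; congr EFin.
  by move: (c^-1)%R => i; lra.
have c4 : (0 <= c / 4)%R by rewrite divr_ge0// ltW.
rewrite /hellinger2 -esumZl// /wsum -!esumD//; apply: le_esum => x _ /=.
have := dist_sqrt_dist2 (f0 x) (g0 x) c0; rewrite ler_norml => /andP[gf fg].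
rewrite mule1 -EFinM -EFinD; move: (sqrt_dist2 _ _) (c^-1)%R gf fg => H i gf fg.
by case: (P x); rewrite mule1 mule0 ?adde0 ?add0e lee_fin; lra.
Qed.

End hellinger2_theory.

Section PoissonHellinger.
Variables (T : choiceType) (f g : T -> R) (m : R).
Hypotheses (f0 : forall x, (0 <= f x)%R) (g0 : forall x, (0 <= g x)%R).
Hypotheses (fm : mass f = m%:E) (gm : mass g = m%:E).

Lemma poisson_weight_affinity l :
  affinity (poisson_weight f) (poisson_weight g) l = poisson_weight (affinity f g) l.
Proof.
rewrite /affinity /poisson_weight mulrACA -expr2 sqrtrM ?sqr_ge0// sqrtr_sqr.
rewrite ger0_norm ?inv_fact_ge0//; congr (_ * _)%R; rewrite -big_split/=.
elim: l => [|x l IH]; first by rewrite !big_nil sqrtr1.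
by rewrite !big_cons sqrtrM ?IH.
Qed.

Lemma poisson_law_affinity (c : R) : mass (affinity f g) = c%:E ->
  mass (affinity (poisson_law f) (poisson_law g)) = (expR (c - m))%:E.
Proof.
move=> ac; have a0 := @affinity_ge0 _ f g.
rewrite addrC expRD EFinM -(mass_poisson_weight a0 ac) -massZ//; last first.
  exact: poisson_weight_ge0.
apply: eq_esum => l _; rewrite !mule1 /= -poisson_weight_affinity; congr EFin.
rewrite /affinity /poisson_law/= fm gm mulrACA -expr2 sqrtrM ?sqr_ge0//.
by rewrite sqrtr_sqr ger0_norm.
Qed.

Lemma hellinger2_poisson_le :
  hellinger2 setT (poisson_law f) (poisson_law g) <= hellinger2 setT f g.
Proof.
have [h -> /poisson_law_affinity aff] := hellinger2_fin f0 g0 fm gm.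
have P0 := poisson_law_ge0.
have := hellinger2_affinity (P0 _ _ _ f0) (P0 _ _ _ g0).
rewrite (mass_poisson_law f0 fm) (mass_poisson_law g0 gm) aff addeC -EFinM -EFinD.
move=> /adde_EFin_inj ->; rewrite lee_fin.
rewrite (_ : (m - _ - m)%R = - (h / 2))%R; last by ring.
by have := expR_ge1Dx (- (h / 2)); lra.
Qed.

Lemma hellinger2_poisson_size_ne1_le :
  hellinger2 (~` [set l | size l = 1%N]) (poisson_law f) (poisson_law g) <=
  (1 - expR (- m))%:E * hellinger2 setT f g.
Proof.
have d0 l : 0 <= (sqrt_dist2 (poisson_law f l) (poisson_law g l))%:E.
  by rewrite lee_fin sqrt_dist2_ge0.
have := hellinger2_poisson_le; have [h hE _] := hellinger2_fin f0 g0 fm gm.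
rewrite {1}/hellinger2 (esumID [set l | size l = 1%N])// !setTI esum_size1//.
rewrite [X in X + _](_ : _ = (expR (- m))%:E * hellinger2 setT f g); last first.
  rewrite -hellinger2Z//; apply: eq_esum => x _.
  by rewrite !poisson_law1 fm gm.
by rewrite hE -!EFinM mulrBl mul1r EFinB leeBrDl.
Qed.

End PoissonHellinger.
End Hellinger.

#[local] Hint Extern 0 (is_true (@Order.le _ _ _ (sqrt_dist2 _ _))) =>
  solve [exact: sqrt_dist2_ge0] : core.
#[local] Hint Extern 0 (is_true (@Order.le _ _ _ (hellinger2 _ _ _))) =>
  solve [exact: hellinger2_ge0] : core.

Lemma hellinger2_node_weight (R : realType) (L : choiceType)
    (p q : seq (tree (option L)) -> R) :
  hellinger2 setT (node_weight p) (node_weight q) = hellinger2 setT p q.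
Proof.
have d0 o : (0 <= (sqrt_dist2 (node_weight p o) (node_weight q o))%:E)%E by [].
rewrite /hellinger2 esum_tree// (@esum_single _ _ None)//.
  exact: hellinger2_ge0.
by case=> // y _; rewrite esum1// => l _; rewrite /= sqrt_dist2xx.
Qed.

(** * Contraction of the Hellinger distance *)

Section Contraction.
Context {R : realType}.
Variables a b : R.
Hypotheses (a0 : 0 < a) (b0 : 0 < b).
Local Notation T := (tree (option bool)).

Definition edge_factor : R := contraction (a / 2) (b / 2).

(* The intensities of the uncut paths joining a vertex to a grandchild of the same
   spin and to a grandchild of the opposite spin. *)
Definition same_spin_paths : R := (a / 2) ^+ 2 + no_dead_prob a b * (b / 2) ^+ 2.
Definition opp_spin_paths : R := 2 * (a / 2) * (b / 2).

Definition path_factor : R := contraction same_spin_paths opp_spin_paths.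

Definition block_factor : R :=
  (1 - expR (- grandchild_rate a b)) * edge_factor ^+ 2 +
  expR (- grandchild_rate a b) * path_factor.

Let a20 : 0 < a / 2. Proof. by rewrite divr_gt0. Qed.
Let b20 : 0 < b / 2. Proof. by rewrite divr_gt0. Qed.
Let childless_prob0 := childless_prob_ge0 a b.
Let no_dead_prob0 := no_dead_prob_ge0 a b.
Let ab20 : 0 < a / 2 + b / 2. Proof. by rewrite addr_gt0. Qed.
Let a2_ge0 := ltW a20.
Let b2_ge0 := ltW b20.

Lemma edge_factor_ge0 : 0 <= edge_factor.
Proof. exact: contraction_ge0. Qed.

Lemma same_spin_paths_gt0 : 0 < same_spin_paths.
Proof. by rewrite ltr_pwDl ?exprn_gt0// mulr_ge0 ?sqr_ge0. Qed.

Lemma opp_spin_paths_ge0 : 0 <= opp_spin_paths.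
Proof. by rewrite /opp_spin_paths. Qed.

Lemma path_factor_ge0 : 0 <= path_factor.
Proof. exact: contraction_ge0 (ltW same_spin_paths_gt0) opp_spin_paths_ge0. Qed.

Lemma grandchild_rate_ge0 : 0 <= grandchild_rate a b.
Proof.
rewrite /grandchild_rate /dead_rate -addrA addr_ge0// subr_ge0 ler_piMr//.
exact: childless_prob_le1.
Qed.

Lemma grandchild_prob_ge0 : 0 <= 1 - expR (- grandchild_rate a b).
Proof. by rewrite subr_ge0 expR_le1 oppr_le0 grandchild_rate_ge0. Qed.

Lemma block_factor_ge0 : 0 <= block_factor.
Proof.
have prob0 := grandchild_prob_ge0.
by rewrite addr_ge0// mulr_ge0 ?sqr_ge0 ?path_factor_ge0.
Qed.

Local Open Scope ereal_scope.

Section NextLaw.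
Variables (d : nat) (L : bool -> T -> R).
Hypothesis L0 : forall s o, (0 <= L s o)%R.
Hypothesis LP : live_law a b d.+1 L.
Local Notation gr := (grandchild_rate a b).

Lemma hellinger2_grandchild :
  hellinger2 setT (grandchild a b L true) (grandchild a b L false) <=
  edge_factor%:E * hellinger2 setT (L true) (L false).
Proof.
apply: (hellinger2_mix (L0 true) (L0 false) (h := a / 2 \*o (childless_prob a b \*o
  (fun o => (o == Node None [::])%:R)))%R) => // o _;
  rewrite /grandchild /own_grandchild /opp_grandchild /=; ring.
Qed.

Lemma forest_intensity_size_ne1 s l : size l != 1%N -> forest_intensity a b L s l =
  (a / 2 * poisson_law (grandchild a b L s) l +
   b / 2 * poisson_law (grandchild a b L (~~ s)) l)%R.
Proof.
rewrite /forest_intensity /own_forest_law /opp_forest_law /= /cut_law.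
by case: l => [|o [|o' l]] // _; rewrite /uncut_law; ring.
Qed.

Definition childless_weight (o : T) : R :=
  (a / 2 * (a / 2 + b / 2) * (childless_prob a b * (o == Node None [::])%:R))%R.

Definition path_intensity s (o : T) : R :=
  (same_spin_paths * L s o + opp_spin_paths * L (~~ s) o + childless_weight o)%R.

Lemma forest_intensity1 s o :
  forest_intensity a b L s [:: o] = (expR (- gr) * path_intensity s o)%R.
Proof.
rewrite /forest_intensity /own_forest_law /opp_forest_law /= /cut_law /uncut_law.
rewrite !poisson_law1 !(mass_grandchild a0 b0 L0 LP)/=.
rewrite /path_intensity /same_spin_paths /opp_spin_paths /childless_weight.
rewrite /grandchild /own_grandchild /opp_grandchild /= negbK; ring.
Qed.

Lemma hellinger2_forest_size1 :
  hellinger2 [set l | size l = 1%N]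
    (forest_intensity a b L true) (forest_intensity a b L false) <=
  (expR (- gr) * path_factor)%:E * hellinger2 setT (L true) (L false).
Proof.
rewrite /hellinger2 esum_size1//.
under eq_esum do rewrite !forest_intensity1.
rewrite [leLHS](hellinger2Z (path_intensity true)) ?expR_ge0// EFinM -muleA.
apply: lee_wpmul2l => //; have S0 := same_spin_paths_gt0; have O0 := opp_spin_paths_ge0.
apply: (hellinger2_mix (L0 true) (L0 false) (h := childless_weight)) => //.
- exact: ltW.
- by rewrite ltr_pwDl.
- by move=> o; rewrite /childless_weight.
- by move=> o _; rewrite /path_intensity [X in (X + _)%R]addrC.
Qed.

Lemma hellinger2_forest_size_ne1 :
  hellinger2 (~` [set l | size l = 1%N])
    (forest_intensity a b L true) (forest_intensity a b L false) <=
  ((1 - expR (- gr)) * edge_factor ^+ 2)%:E * hellinger2 setT (L true) (L false).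
Proof.
have Q0 := grandchild_ge0 a0 b0 L0.
have Qm := mass_grandchild a0 b0 L0 LP.
have prob0 := grandchild_prob_ge0.
apply: (@le_trans _ _ (edge_factor%:E * hellinger2 (~` [set l | size l = 1%N])
  (poisson_law (grandchild a b L true)) (poisson_law (grandchild a b L false)))).
  apply: (hellinger2_mix (poisson_law_ge0 (Q0 true)) (poisson_law_ge0 (Q0 false))
    (h := fun=> 0%R)) => // l /eqP/forest_intensity_size_ne1 ->; rewrite addr0//.
  by rewrite addrC.
rewrite expr2 mulrCA (EFinM edge_factor) -muleA.
apply: lee_wpmul2l; first by rewrite lee_fin edge_factor_ge0.
have := hellinger2_poisson_size_ne1_le (Q0 true) (Q0 false) (Qm true) (Qm false).
move=> /le_trans; apply.
by rewrite EFinM -muleA; apply: lee_wpmul2l => //; exact: hellinger2_grandchild.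
Qed.

Lemma hellinger2_child_intensity :
  hellinger2 setT (child_intensity a b L true) (child_intensity a b L false) <=
  block_factor%:E * hellinger2 setT (L true) (L false).
Proof.
rewrite hellinger2_node_weight.
have prob0 := grandchild_prob_ge0; have pf0 := path_factor_ge0.
rewrite /block_factor EFinD addrC.
rewrite ge0_muleDl; last 2 first.
- by [].
- by rewrite lee_fin mulr_ge0 ?sqr_ge0.
rewrite {1}/hellinger2 (esumID [set l | size l = 1%N])// !setTI.
exact: leeD hellinger2_forest_size1 hellinger2_forest_size_ne1.
Qed.

Lemma hellinger2_next_law :
  hellinger2 setT (next_law a b L true) (next_law a b L false) <=
  block_factor%:E * hellinger2 setT (L true) (L false).
Proof.
have C0 := child_intensity_ge0 a0 b0 L0; have Cm := mass_child_intensity a0 b0 L0 LP.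
apply: le_trans hellinger2_child_intensity.
apply: le_trans (hellinger2_poisson_le (C0 true) (C0 false) (Cm true) (Cm false)).
rewrite hellinger2_node_weight; apply: le_esum => -[|o l] _.
  by rewrite !poisson_law_nil !Cm sqrt_dist2xx lee_fin.
by rewrite /= !mul0r !subr0.
Qed.

End NextLaw.
End Contraction.

(** * Impossibility of recovery *)

Section Pushforward.
Context {R : realType}.
Local Open Scope ereal_scope.
Variables (X Y : choiceType) (w : X -> R) (g : X -> Y) (m : R).
Hypothesis w0 : forall x, (0 <= w x)%R.
Hypothesis wm : mass w <= m%:E.

Definition pushforward (y : Y) : R := fine (\esum_(x in [set x | g x = y]) (w x)%:E).

Lemma pushforwardE y : (pushforward y)%:E = \esum_(x in [set x | g x = y]) (w x)%:E.
Proof.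
rewrite fineK// ge0_fin_numE; last by apply: esum_ge0.
apply: (@le_lt_trans _ _ m%:E); last exact: ltry.
rewrite (le_trans _ wm)// esum_mkcond; apply: le_esum => x _.
by rewrite mule1; case: ifP.
Qed.

Lemma pushforward_ge0 y : (0 <= pushforward y)%R.
Proof. by rewrite -lee_fin pushforwardE; apply: esum_ge0. Qed.

Lemma wsum_pushforward (f : Y -> \bar R) : (forall y, 0 <= f y) ->
  wsum pushforward f = wsum w (f \o g).
Proof.
move=> f0; transitivity (\esum_(y in [set: Y]) \esum_(x in [set x | g x = y])
    ((w x)%:E * f y)).
  apply: eq_esum => y _; rewrite muleC pushforwardE -esumZl//.
  by apply: eq_esum => x _; rewrite muleC.
rewrite esum_esum// (@reindex_esum _ _ _ [set: X]
  ([set: Y] `*`` (fun y => [set x | g x = y])) (fun x => (g x, x)))//.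
split=> //; first by move=> x x' _ _ [].
by move=> [y x] [_ /= <-]; exists x.
Qed.

End Pushforward.

Section Recovery.
Context {R : realType}.
Variables a b : R.
Hypotheses (a0 : 0 < a) (b0 : 0 < b).
Local Notation T := (tree (option bool)).
Local Notation empty := (Node None [::] : T).
Local Open Scope ereal_scope.

Lemma broadcast_pmf_nil d s :
  broadcast_pmf a b d.+1 s (Node s [::]) = childless_prob a b.
Proof.
rewrite -[[::]]/([::] ++ [::]) broadcast_pmfS//; last exact: mass_broadcast.
by rewrite !poisson_law_nil mass_own_intensity// mass_opp_intensity// -expRD -opprD.
Qed.

Definition parent_pmf d s (t : tree bool) : R :=
  if childless t then 0%R else broadcast_pmf a b d s t.

Lemma parent_pmf_ge0 d s t : (0 <= parent_pmf d s t)%R.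
Proof. by rewrite /parent_pmf; case: ifP. Qed.

Lemma mass_parent_pmf_le d s : mass (parent_pmf d s) <= 1%:E.
Proof.
rewrite -(mass_broadcast a0 b0 d s); apply: le_esum => t _.
by rewrite !mule1 /parent_pmf; case: ifP.
Qed.

Lemma wsum_broadcast_childless d s (F : tree bool -> \bar R) : (forall t, 0 <= F t) ->
  wsum (broadcast_pmf a b d.+1 s) F =
  wsum (parent_pmf d.+1 s) F + (childless_prob a b)%:E * F (Node s [::]).
Proof.
move=> F0; pose childless_part t :=
  if childless t then (broadcast_pmf a b d.+1 s t)%:E * F t else 0.
have childless_part0 t : 0 <= childless_part t by rewrite /childless_part.
have P0 := parent_pmf_ge0 d.+1 s.
have -> : (childless_prob a b)%:E * F (Node s [::]) =
    \esum_(t in [set: tree bool]) childless_part t.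
  rewrite (@esum_single _ _ (Node s [::]))//.
    by rewrite -(broadcast_pmf_nil d s).
  move=> [x [|c l]] //= xs; rewrite /childless_part.
  have [->|/broadcast_pmf_root/= xE] :=
    eqVneq (broadcast_pmf a b d.+1 s (Node x [::])) 0%R; first by rewrite mul0e.
  by rewrite xE eqxx in xs.
rewrite /wsum -esumD//; apply: eq_esum => t _; rewrite /parent_pmf /childless_part.
by case: childless; rewrite ?mul0e ?add0e ?adde0.
Qed.

Definition first_law d s : T -> R := pushforward (parent_pmf d.+1 s) (observation d.+1).

Lemma live_law_first d : live_law a b d.+1 (first_law d).
Proof.
move=> s F F0 Fi; rewrite wsum_broadcast_childless//; congr (_ + _).
  rewrite (wsum_pushforward _ (@parent_pmf_ge0 _ _) (mass_parent_pmf_le _ _))//.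
  by apply: eq_esum => t _; rewrite /parent_pmf /=; case: childless; rewrite ?mul0e.
by rewrite /observation adversary_childless.
Qed.

Lemma first_law_ge0 d s o : (0 <= first_law d s o)%R.
Proof. exact: pushforward_ge0 (@parent_pmf_ge0 _ _) (mass_parent_pmf_le _ _) _. Qed.

Lemma hellinger2_live_law_le d L : (forall s o, (0 <= L s o)%R) ->
  live_law a b d.+1 L -> hellinger2 setT (L true) (L false) <= 2%:E.
Proof.
move=> L0 LP; apply: le_trans (hellinger2_le_mass (L0 true) (L0 false)) _.
rewrite !(mass_live_law a0 b0 LP) -EFinD lee_fin.
by have := childless_prob_ge0 a b; lra.
Qed.

Lemma live_law_contracting n : exists L : bool -> T -> R,
  [/\ forall s o, (0 <= L s o)%R, live_law a b n.*2.+1 L &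
      hellinger2 setT (L true) (L false) <= (2 * block_factor a b ^+ n)%:E].
Proof.
elim: n => [|n [L [L0 LP Lh]]].
  exists (first_law 0); rewrite mulr1; split; first exact: first_law_ge0.
    exact: live_law_first.
  exact: (hellinger2_live_law_le (@first_law_ge0 0) (@live_law_first 0)).
exists (next_law a b L); split.
- exact: next_law_ge0 LP.
- exact: live_law_step LP.
apply: le_trans (hellinger2_next_law a0 b0 L0 LP) _.
rewrite exprS mulrCA EFinM lee_wpmul2l//.
by rewrite lee_fin block_factor_ge0.
Qed.

Lemma broadcast_prob_test d (E : tree bool -> bool) :
  broadcast_prob a b d [set t | E t = root_label t] =
  (2^-1)%:E * (wsum (broadcast_pmf a b d true) (fun t => if E t then 1 else 0) +
               wsum (broadcast_pmf a b d false) (fun t => if E t then 0 else 1)).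
Proof.
rewrite /broadcast_prob esum_mkcond /wsum -esumD// -esumZl//.
apply: eq_esum => t _.
have pmf0 s : root_label t != s -> broadcast_pmf a b d s t = 0%R.
  by move=> ts; apply: contraNeq ts => /broadcast_pmf_root ->.
rewrite (_ : (t \in _) = (E t == root_label t)); last by apply/idP/eqP; rewrite inE.
case: (root_label t) pmf0 => pmf0; [rewrite (pmf0 false)//|rewrite (pmf0 true)//];
  by case: (E t); rewrite /= ?mul0e ?add0e ?adde0 ?mule0 ?mule1 ?EFinM.
Qed.

Lemma recovery_bound d L est (c h : R) :
  (forall s o, (0 <= L s o)%R) -> live_law a b d.+1 L -> root_estimator est ->
  (0 < c)%R -> hellinger2 setT (L true) (L false) <= h%:E ->
  broadcast_prob a b d.+1
    [set t | est d.+1 (observe d.+1 (adversary d.+1 t)) = root_label t] <=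
  (2^-1 + (c * h / 8 + c^-1 / 2))%:E.
Proof.
move=> L0 LP estP c0 Lh; pose P o := est d.+1 o.
rewrite (broadcast_prob_test _ (fun t => P (observation d.+1 t))).
have observed s (I : T -> \bar R) : (forall o, 0 <= I o) ->
    (forall o o', P o = P o' -> I o = I o') ->
    wsum (broadcast_pmf a b d.+1 s) (fun t => I (observation d.+1 t)) =
    wsum (L s) I + (childless_prob a b)%:E * I empty.
  move=> I0 IP; rewrite (LP s (fun=> I))// => _ o o' oo.
  exact/IP/estP.
rewrite (observed true (fun o => if P o then 1 else 0))//; last by move=> o o' ->.
rewrite (observed false (fun o => if P o then 0 else 1))//; last by move=> o o' ->.
have p0 := childless_prob_ge0 a b; have LM := mass_live_law a0 b0 LP.
rewrite addeACA -ge0_muleDr// [X in (childless_prob a b)%:E * X](_ : _ = 1); last first.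
  by case: (P empty); rewrite ?adde0 ?add0e.
have test := wsum_test_le (L0 true) (L0 false) P c0 (LM true) (LM false).
apply: (@le_trans _ _ ((2^-1)%:E * ((1 - childless_prob a b +
  c^-1 * (1 - childless_prob a b))%:E + (c / 4)%:E * h%:E + (childless_prob a b)%:E))).
  rewrite lee_wpmul2l// mule1 leeD2r// (le_trans test)// leeD2l//.
  by rewrite lee_wpmul2l// lee_fin divr_ge0// ltW.
rewrite -!EFinM lee_fin.
have : (0 <= c^-1 * childless_prob a b)%R by rewrite mulr_ge0// invr_ge0 ltW.
by move: (c^-1)%R => i; lra.
Qed.

Lemma no_partial_recovery est : (block_factor a b < 1)%R -> root_estimator est ->
  ~ partial_recovery a b adversary est.
Proof.
move=> lt1 estP [eta eta2 [N _ HN]].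
have bf0 := block_factor_ge0 a0 b0.
pose gain := (eta - 2^-1)%R; have gain0 : (0 < gain)%R by rewrite subr_gt0.
pose c := (2 / gain)%R; have c0 : (0 < c)%R by rewrite divr_gt0.
have : (fun n => block_factor a b ^+ n)%R @ \oo --> (0 : R)%R.
  by apply: cvg_expr; rewrite ger0_norm.
move=> /cvgrPdist_lt /(_ (gain / c)%R (divr_gt0 gain0 c0))[M _ HM].
pose n := maxn N M.
have /= := HM n (leq_maxr N M).
rewrite sub0r normrN ger0_norm ?exprn_ge0// ltr_pdivlMr// => small.
have [L [L0 LP Lh]] := live_law_contracting n.
have Nn : (N <= n.*2.+1)%N.
  by rewrite -addnn ltnW// ltnS (leq_trans (leq_maxl N M))// leq_addr.
have := le_trans (HN _ Nn) (recovery_bound L0 LP estP c0 Lh).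
apply/negP; rewrite -ltNge lte_fin.
have -> : (c^-1 = gain / 2)%R by rewrite /c invf_div.
have -> : eta = (2^-1 + gain)%R by rewrite /gain addrC subrK.
move: small gain0; move: (block_factor a b ^+ n)%R => z; lra.
Qed.

End Recovery.

(** * Choice of eps *)

Section Threshold.
Context {R : realType}.
Variable k : R.
Hypothesis k1 : 1 < k.

Let k0 : 0 < k. Proof. exact: lt_trans ltr01 k1. Qed.

Local Notation own_mean eps := (2 * k * (1 - eps)).
Local Notation opp_mean eps := (2 * k * eps).

Definition eps_factor (eps : R) : R := block_factor (own_mean eps) (opp_mean eps).

Definition cut_fraction (eps : R) : R :=
  eps ^+ 2 * (1 - no_dead_prob (own_mean eps) (opp_mean eps)).

Lemma own_mean_half eps : own_mean eps / 2 = k * (1 - eps). Proof. by field. Qed.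
Lemma opp_mean_half eps : opp_mean eps / 2 = k * eps. Proof. by field. Qed.

Lemma dead_rateE eps : dead_rate (own_mean eps) (opp_mean eps) = k * eps * expR (- k).
Proof.
rewrite /dead_rate /childless_prob own_mean_half opp_mean_half.
by congr (_ * expR _); ring.
Qed.

Lemma edge_factorE eps :
  edge_factor (own_mean eps) (opp_mean eps) = k * (1 - 2 * eps) ^+ 2.
Proof.
rewrite /edge_factor /contraction own_mean_half opp_mean_half.
by rewrite -mulrDr subrK mulr1; field; rewrite gt_eqF.
Qed.

Lemma pathsB eps :
  same_spin_paths (own_mean eps) (opp_mean eps) -
    opp_spin_paths (own_mean eps) (opp_mean eps) =
  k ^+ 2 * ((1 - 2 * eps) ^+ 2 - cut_fraction eps).
Proof.
rewrite /same_spin_paths /opp_spin_paths /cut_fraction own_mean_half opp_mean_half.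
ring.
Qed.

Lemma pathsD eps :
  same_spin_paths (own_mean eps) (opp_mean eps) +
    opp_spin_paths (own_mean eps) (opp_mean eps) =
  k ^+ 2 * (1 - cut_fraction eps).
Proof.
rewrite /same_spin_paths /opp_spin_paths /cut_fraction own_mean_half opp_mean_half.
ring.
Qed.

Lemma path_factorE eps : cut_fraction eps < 1 ->
  path_factor (own_mean eps) (opp_mean eps) =
  k ^+ 2 * (((1 - 2 * eps) ^+ 2 - cut_fraction eps) ^+ 2 / (1 - cut_fraction eps)).
Proof.
move=> x1; rewrite /path_factor /contraction pathsB pathsD.
by field; rewrite !gt_eqF// subr_gt0.
Qed.

Lemma cut_fraction_lt1 eps : 0 <= eps <= 1 -> cut_fraction eps < 1.
Proof.
move=> /andP[e0 e1].
apply: (@le_lt_trans _ _ (1 - no_dead_prob (own_mean eps) (opp_mean eps))).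
  rewrite ler_piMl ?expr_le1// subr_ge0 expR_le1 oppr_le0 dead_rateE.
  by rewrite !mulr_ge0 ?expR_ge0// ltW.
by rewrite ltrBlDr ltrDl expR_gt0.
Qed.

Lemma cut_fraction_gt0 eps : 0 < eps -> 0 < cut_fraction eps.
Proof.
move=> e0; rewrite mulr_gt0 ?exprn_gt0// subr_gt0 expR_lt1 oppr_lt0 dead_rateE.
by rewrite !mulr_gt0 ?expR_gt0.
Qed.

Lemma sqr_lt_expR : k ^+ 2 < 8 * expR k.
Proof.
have : (1 + k / 2) ^+ 2 <= expR (k / 2) ^+ 2.
  by rewrite ler_sqr ?nnegrE ?expR_ge1Dx ?expR_ge0// addr_ge0// divr_ge0// ltW.
rewrite -expRM_natr (_ : k / 2 * 2%:R = k); last by field.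
by have := k0; move: (expR k) => z; nra.
Qed.

Lemma mul_cut_fraction_lt1 eps : 0 < eps -> eps < 2^-1 -> k * cut_fraction eps < 1.
Proof.
move=> e0 e2; have D0 := expR_gt0 (- k).
have x_le : cut_fraction eps <= eps ^+ 2 * (k * eps * expR (- k)).
  rewrite ler_wpM2l ?sqr_ge0// /no_dead_prob dead_rateE.
  by have := expR_ge1Dx (- (k * eps * expR (- k))); lra.
have kD : k ^+ 2 * expR (- k) < 8.
  by rewrite expRN ltr_pdivrMr ?expR_gt0// sqr_lt_expR.
have e3 : eps ^+ 3 <= 8^-1.
  rewrite (_ : 8^-1 = (2^-1) ^+ 3); last by field.
  by apply: lerXn2r; rewrite ?nnegrE ?invr_ge0// ltW.
apply: (@le_lt_trans _ _ (eps ^+ 3 * (k ^+ 2 * expR (- k)))).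
  apply: le_trans (ler_wpM2l (ltW k0) x_le) _.
  by rewrite le_eqVlt; apply/orP; left; apply/eqP; ring.
apply: (@le_lt_trans _ _ (8^-1 * (k ^+ 2 * expR (- k)))).
  by rewrite ler_wpM2r// mulr_ge0 ?sqr_ge0 ?ltW.
by rewrite mulrC ltr_pdivrMr// mul1r.
Qed.

Definition critical_eps : R := (1 - Num.sqrt k^-1) / 2.

Lemma critical_eps_gt0 : 0 < critical_eps.
Proof. by rewrite divr_gt0// subr_gt0 -[ltRHS]sqrtr1 ltr_sqrt// invf_lt1. Qed.

Lemma critical_eps_lt : critical_eps < 2^-1.
Proof. by rewrite ltr_pdivrMr// mulVf// ltrBlDr ltrDl sqrtr_gt0 invr_gt0. Qed.

Lemma critical_epsE : k * (1 - 2 * critical_eps) ^+ 2 = 1.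
Proof.
rewrite /critical_eps (_ : 1 - _ = Num.sqrt k^-1); last by field.
by rewrite sqr_sqrtr ?invr_ge0 ?ltW// divff// gt_eqF.
Qed.

Lemma cut_fraction_critical_lt1 : cut_fraction critical_eps < 1.
Proof.
by apply: cut_fraction_lt1; have := critical_eps_gt0; have := critical_eps_lt; lra.
Qed.

Lemma path_factor_critical :
  path_factor (own_mean critical_eps) (opp_mean critical_eps) < 1.
Proof.
have x1 := cut_fraction_critical_lt1; rewrite path_factorE//.
have x0 := cut_fraction_gt0 critical_eps_gt0.
have kx := mul_cut_fraction_lt1 critical_eps_gt0 critical_eps_lt.
move: (cut_fraction _) x0 x1 kx => x x0 x1 kx.
rewrite mulrA ltr_pdivrMr ?subr_gt0// mul1r -exprMn mulrBr critical_epsE -subr_gt0.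
rewrite (_ : 1 - x - (1 - k * x) ^+ 2 = x * (k * (1 - k * x) + (k - 1))); last by ring.
by rewrite mulr_gt0// addr_gt0 ?mulr_gt0 ?subr_gt0.
Qed.

Lemma eps_factor_critical : eps_factor critical_eps < 1.
Proof.
rewrite /eps_factor /block_factor edge_factorE critical_epsE expr1n mulr1.
have := path_factor_critical; move: (path_factor _ _) => p p1.
have := expR_gt0 (- grandchild_rate (own_mean critical_eps) (opp_mean critical_eps)).
by move: (expR _) => E E0; nra.
Qed.

Let expR_cvg (f : R -> R) (y : R) :
  f e @[e --> critical_eps] --> y -> expR (f e) @[e --> critical_eps] --> expR y.
Proof. by move=> fy; apply: (cvg_comp _ _ fy); exact: continuous_expR. Qed.

Let sqr_cvg (f : R -> R) (y : R) :
  f e @[e --> critical_eps] --> y -> f e ^+ 2 @[e --> critical_eps] --> y ^+ 2.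
Proof. by move=> fy; exact: (cvgM fy fy). Qed.

Lemma eps_factor_cvg : eps_factor e @[e --> critical_eps] --> eps_factor critical_eps.
Proof.
have own : own_mean e / 2 @[e --> critical_eps] --> own_mean critical_eps / 2.
  exact: cvgMr_tmp (cvgMl_tmp (cvgB (cvg_cst _) cvg_id)).
have opp : opp_mean e / 2 @[e --> critical_eps] --> opp_mean critical_eps / 2.
  exact: cvgMr_tmp (cvgMl_tmp cvg_id).
have dead : dead_rate (own_mean e) (opp_mean e) @[e --> critical_eps] -->
    dead_rate (own_mean critical_eps) (opp_mean critical_eps).
  exact: cvgM opp (expR_cvg (cvgN (cvgD own opp))).
have no_grandchild :
    expR (- grandchild_rate (own_mean e) (opp_mean e)) @[e --> critical_eps] -->
    expR (- grandchild_rate (own_mean critical_eps) (opp_mean critical_eps)).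
  exact: expR_cvg (cvgN (cvgB (cvgD own opp) dead)).
have same : same_spin_paths (own_mean e) (opp_mean e) @[e --> critical_eps] -->
    same_spin_paths (own_mean critical_eps) (opp_mean critical_eps).
  exact: cvgD (sqr_cvg own) (cvgM (expR_cvg (cvgN dead)) (sqr_cvg opp)).
have opp_paths : opp_spin_paths (own_mean e) (opp_mean e) @[e --> critical_eps] -->
    opp_spin_paths (own_mean critical_eps) (opp_mean critical_eps).
  exact: cvgM (cvgMl_tmp own) opp.
have own_opp : own_mean critical_eps / 2 + opp_mean critical_eps / 2 != 0.
  by rewrite own_mean_half opp_mean_half -mulrDr subrK mulr1 gt_eqF.
have same_opp : same_spin_paths (own_mean critical_eps) (opp_mean critical_eps) +
    opp_spin_paths (own_mean critical_eps) (opp_mean critical_eps) != 0.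
  by rewrite pathsD mulf_neq0 ?expf_neq0 ?gt_eqF// subr_gt0 cut_fraction_critical_lt1.
have edge : edge_factor (own_mean e) (opp_mean e) @[e --> critical_eps] -->
    edge_factor (own_mean critical_eps) (opp_mean critical_eps).
  exact: cvgM (sqr_cvg (cvgB own opp)) (cvgV own_opp (cvgD own opp)).
have path : path_factor (own_mean e) (opp_mean e) @[e --> critical_eps] -->
    path_factor (own_mean critical_eps) (opp_mean critical_eps).
  exact: cvgM (sqr_cvg (cvgB same opp_paths)) (cvgV same_opp (cvgD same opp_paths)).
exact: cvgD (cvgM (cvgB (cvg_cst _) no_grandchild) (sqr_cvg edge))
  (cvgM no_grandchild path).
Qed.

Lemma subcritical_eps : exists eps : R,
  [/\ 0 < eps, eps < 2^-1, 1 < k * (1 - 2 * eps) ^+ 2 & eps_factor eps < 1].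
Proof.
have e2 := critical_eps_lt.
have positive := nbhs_left_gt critical_eps_gt0.
have below := nbhs_left_lt critical_eps.
have contracting : \forall e \near critical_eps^'-, eps_factor e < 1.
  exact: (cvgr_lt _ (cvg_at_left_filter eps_factor_cvg) _ eps_factor_critical).
have [e [[e0 ec] e1]] := filter_ex (filterI (filterI positive below) contracting).
exists e; split => //; first exact: lt_trans ec e2.
by rewrite -[ltLHS]critical_epsE ltr_pM2l// ltr_sqr ?nnegrE; move: ec e2; lra.
Qed.

End Threshold.

Theorem theorem3 (R : realType) (k : R) (hk : 1 < k) :
  exists eps : R,
    [/\ 0 < eps, eps < 2^-1, 1 < k * (1 - 2 * eps) ^+ 2 &
      exists2 adv : nat -> tree bool -> tree bool,
        cutting_adversary adv &
        forall est : nat -> tree (option bool) -> bool,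
          root_estimator est ->
          ~ partial_recovery (2 * k * (1 - eps)) (2 * k * eps) adv est].
Proof.
have k0 : 0 < k := lt_trans ltr01 hk.
have [eps [e0 e2 reconstructible contracting]] := subcritical_eps hk.
have e1 : eps < 1 by move: e2; lra.
exists eps; split => //; exists adversary; first exact: adversary_cutting.
move=> est estP; apply: no_partial_recovery => //; last by rewrite !mulr_gt0.
by rewrite !mulr_gt0// subr_gt0.
Qed.
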